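(* Let $n\geq 2$, $m\geq 1$, and let $A=\{\alpha_1,\ldots,\alpha_m\}$ be a set of numbers $-1<\alpha_1<\ldots<\alpha_m<1$ symmetric about the origin. Suppose there exists a weighted $(m-1,m-1)$-design $(C,W)=(x_1,\ldots,x_N;w_1,\ldots,w_N)$ on $\mathbb{S}^{n-1}$ such that any dot product formed by a pair of points from $C$ lies in the set $A\cup \{-1,1\}$. Let $\mu^\ast=\kappa(C,W)=\sum_{i=1}^N w_i\delta_{x_i}$. Let $f:[0,1]\to \mathbb R$ be a continuous function such that $f^{(k)}\geq 0$ in $(0,1)$ for $k=1,\ldots,m$. If $\mu$ is any Borel probability measure on $\mathbb S^{n-1}$ with $\theta_\mu\geq \theta_{\mu^\ast}$, then $$E_f(\mu)\geq E_f(\mu^\ast)=\sum_{i,j=1}^{N}w_iw_jf\left((x_i\cdot x_j)^2\right).\qquad( * )$$ Assume, in addition, that $f^{(k)}>0$ on $(0,1)$ for $k=1,\ldots,m$. Then (for a Borel probability measure $\mu$ with $\theta_\mu\ge\theta_{\mu^\ast}$) equality in $( * )$ holds if and only if $\mu$ is an $(m-1,m-1)$-design, $(\mu\times \mu)\left(D_{(-1,1)\setminus A}\right)=0$, and $\theta_\mu=\theta_{\mu^\ast}$.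
   Context: $\mathbb S^{n-1}$ is the unit sphere in $\mathbb R^n$ and $x\cdot y$ is the standard dot product. A weighted code $(C,W)=(x_1,\ldots,x_N;w_1,\ldots,w_N)$ on $\mathbb S^{n-1}$ consists of $N\ge1$ pairwise distinct points $x_1,\dots,x_N\in\mathbb S^{n-1}$, $C=\{x_1,\ldots,x_N\}$, and weights $w_i>0$ with $w_1+\ldots+w_N=1$; $\kappa(C,W):=\sum_{i=1}^N w_i\delta_{x_i}$, where $\delta_x$ is the unit Dirac mass at $x$. $P_k^{(n)}$ is the Gegenbauer polynomial of degree $k$: the polynomial of degree $k$ orthogonal to all polynomials of degree less than $k$ on $[-1,1]$ with weight $(1-t^2)^{(n-3)/2}$, normalized by $P_k^{(n)}(1)=1$. A Borel probability measure $\mu$ on $\mathbb S^{n-1}$ is a $(k,k)$-design, $k\ge1$, if $\int_{\mathbb S^{n-1}}\int_{\mathbb S^{n-1}}P_{2\ell}^{(n)}(x\cdot y)\,d\mu(x)\,d\mu(y)=0$ for $\ell=1,\ldots,k$; every Borel probability measure on $\mathbb S^{n-1}$ is a $(0,0)$-design. A weighted code $(C,W)$ is a weighted $(k,k)$-design if $\kappa(C,W)$ is a $(k,k)$-design. For $K\subset[-1,1]$, $D_K:=\{(x,y)\in\mathbb S^{n-1}\times\mathbb S^{n-1}: x\cdot y\in K\}$. For a Borel probability measure $\mu$ on $\mathbb S^{n-1}$, $\theta_\mu:=(\mu\times\mu)(D_{\{-1,1\}})$. For continuous $f:[0,1]\to\mathbb R$, the $f$-energy is $E_f(\mu):=\int_{\mathbb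 S^{n-1}}\int_{\mathbb S^{n-1}}f\left((x\cdot y)^2\right)d\mu(y)\,d\mu(x)$. Conditions on $f^{(k)}$ on $(0,1)$ include the existence of these derivatives there. *)

(* Defs.v *)
From HB Require Import structures.
From mathcomp Require Import all_boot all_order all_algebra.
From mathcomp Require Import all_classical all_reals all_analysis.
Set Implicit Arguments.
Unset Strict Implicit.
Unset Printing Implicit Defensive.
Import Order.TTheory GRing.Theory Num.Theory.
Import numFieldNormedType.Exports.
Local Open Scope classical_set_scope.
Local Open Scope ring_scope.

Definition dot (R : realType) (n : nat) (u v : 'rV[R]_n) : R :=
  \sum_(i < n) u 0 i * v 0 i.

(* The library norm on ['rV[R]_n] is the sup norm, so the Euclidean sphere is
   given through the dot product (the two norms induce the same topology). *)
Definition unit_sphere (R : realType) (n : nat) : set 'rV[R]_n :=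
  [set u | dot u u = 1].
Arguments unit_sphere : clear implicits.

(* The unit sphere of R^n as a type.  The proof of [2 <= n] only serves to
   exhibit a point: measurable types are required to be pointed. *)
Definition sphere (R : realType) (n : nat) (hn : (2 <= n)%N) : Type :=
  set_type (unit_sphere R n).

Section SphereStructures.
Variables (R : realType) (n : nat) (hn : (2 <= n)%N).

Let e0 : 'rV[R]_n := delta_mx 0 (Ordinal (ltnW hn)).

Let e0_sphere : e0 \in unit_sphere R n.
Proof.
rewrite inE /unit_sphere /= /dot (bigD1 (Ordinal (ltnW hn)))//= big1.
  by rewrite !mxE !eqxx mulr1 addr0.
by move=> i ne; rewrite !mxE (negbTE ne) andbF mul0r.
Qed.

HB.instance Definition _ :=
  Topological.copy (sphere R hn) (set_type (unit_sphere R n)).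
HB.instance Definition _ := isPointed.Build (sphere R hn) (exist _ e0 e0_sphere).
HB.instance Definition _ := Measurable.copy (sphere R hn)
  (g_sigma_algebraType (@open (sphere R hn))).

Definition sdot (x y : sphere R hn) : R := dot (\val x) (\val y).

Definition dot_in (K : set R) : set (sphere R hn * sphere R hn) :=
  [set xy | K (sdot xy.1 xy.2)].

End SphereStructures.

Record weighted_code (R : realType) (T : Type) (N : nat) := WeightedCode {
  code_pt : 'I_N -> T ;
  code_wt : 'I_N -> R ;
  code_size_gt0 : (0 < N)%N ;
  code_pt_inj : injective code_pt ;
  code_wt_gt0 : forall i, 0 < code_wt i ;
  code_wt_sum : \sum_(i < N) code_wt i = 1 }.

Section Kappa.
Variables (R : realType) (d : measure_display) (T : measurableType d) (N : nat).
Variable C : weighted_code R T N.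
Local Open Scope ereal_scope.

Definition kappa (A : set T) : \bar R :=
  \sum_(i < N) (code_wt C i)%:E * \d_(code_pt C i) A.

Let m (k : nat) : {measure set T -> \bar R} :=
  if insub k is Some i then
    mscale (NngNum (ltW (code_wt_gt0 C i))) (dirac (code_pt C i))
  else mzero.

Let kappaE : kappa = msum m N.
Proof.
apply/funext => A; rewrite /kappa /msum; apply: eq_bigr => i _.
by rewrite /m valK.
Qed.

Let kappa0 : kappa set0 = 0.
Proof. by rewrite kappaE measure0. Qed.

Let kappa_ge0 A : 0 <= kappa A.
Proof. by rewrite kappaE measure_ge0. Qed.

Let kappa_sigma_additive : semi_sigma_additive kappa.
Proof. by rewrite kappaE; exact: measure_semi_sigma_additive. Qed.

HB.instance Definition _ :=
  isMeasure.Build _ _ _ kappa kappa0 kappa_ge0 kappa_sigma_additive.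

Let kappa_setT : kappa setT = 1.
Proof.
rewrite /kappa -[RHS]/(1%R%:E) -(code_wt_sum C) -sumEFin.
by apply: eq_bigr => i _; rewrite diracT mule1.
Qed.

HB.instance Definition _ := Measure_isProbability.Build _ _ _ kappa kappa_setT.
End Kappa.

(* For [n = 2] the weight is singular at -1 and 1, where [powR] takes the
   value 0; this does not affect the integrals. *)
Definition gegenbauer_spec (R : realType) (n k : nat) (p : {poly R}) : Prop :=
  [/\ size p = k.+1,
      forall q : {poly R}, (size q <= k)%N ->
        \int[@lebesgue_measure R]_(t in `[-1, 1])
          (p.[t] * q.[t] * (1 - t ^+ 2) `^ ((n%:R - 3) / 2)) = 0 &
      p.[1] = 1].

(* The polynomial P_k^(n): for [2 <= n], [gegenbauer_spec R n k] has exactly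
   one solution. *)
Definition gegenbauer (R : realType) (n k : nat) : {poly R} :=
  xget 0 [set p | gegenbauer_spec n k p].

Section Designs.
Variables (R : realType) (n : nat) (hn : (2 <= n)%N).
Implicit Type mu : probability (sphere R hn) R.

Definition is_design (k : nat) mu : Prop :=
  forall l : nat, (1 <= l <= k)%N ->
    \int[mu]_x \int[mu]_y (gegenbauer R n (2 * l)).[sdot x y] = 0.

Definition is_weighted_design (k N : nat)
    (C : weighted_code R (sphere R hn) N) : Prop :=
  is_design k (kappa C).

Definition theta mu : \bar R := (mu \x mu)%E (@dot_in R n hn [set -1; 1]).

Definition energy (f : R -> R) mu : R :=
  \int[mu]_x \int[mu]_y f (sdot x y ^+ 2).

End Designs.

(* Main.v *)
Require Import Defs.
From HB Require Import structures.
From mathcomp Require Import all_boot all_order all_algebra.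
From mathcomp Require Import all_classical all_reals all_analysis.
From mathcomp Require Import measurable_realfun.
From mathcomp Require Import -(notations) mpoly.
From mathcomp Require Import ring lra zify.
Set Implicit Arguments.
Unset Strict Implicit.
Unset Printing Implicit Defensive.
Import Order.TTheory GRing.Theory Num.Theory.
Import numFieldNormedType.Exports.
Local Open Scope classical_set_scope.
Local Open Scope ring_scope.

(** The potential f is compared with a function of s = (x . y)^2 that is easy to
    integrate.  Let h be the polynomial of degree at most m - 1 that interpolates f
    at the squares of the elements of A, to second order at the squares different
    from 0.  By Rolle's theorem the error f - h is f^(m) / m! times a product that
    is nonnegative on [0, 1], so f dominates h + (f(1) - h(1)) 1_(s = 1), with
    equality at the nodes and at 1 ([hermite_minorant]).  Hence for every mu the
    energy is the energy of h, plus (f(1) - h(1)) theta, plus a nonnegative integral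
    which is 0 for the code.

    It remains to see that the code minimises the energy of h.  In Newton form h is
    a combination of partial products of the nodes, with coefficients f^(k) / k!,
    nonnegative for k >= 1.  If a product q, read as the kernel q((x . y)^2), is
    positive semidefinite, then applying positivity to mu - kappa shows that its
    energy is at least its average over the sphere, which is its energy for the
    code ([psd_energy]).  In the strict case equality forces exactness on every
    partial product; they form a basis, so mu is a design.

    Positive semidefiniteness of the partial products ([psd_nodal]) rests on three
    facts.  First, Gegenbauer polynomials are positive semidefinite: the Fischer
    inner product of two zonal harmonics H_x and H_y is a multiple of P_k(x . y)
    ([fischer_zonal_harm], [psd_zonal]).  Secondly, the squared dot products seen from a
    point of the code carry a positive discrete measure which is exact for even
    polynomials of degree at most 2 (m - 1), so its orthogonal polynomials are
    Gegenbauer polynomials in disguise ([isOP_zonal_sq]).  Thirdly, for a discrete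
    measure the products of the first linear factors are nonnegative combinations
    of its orthogonal polynomials ([cone_prefix_prod]).

    The Gegenbauer polynomials, characterised by integrals, are identified with
    the explicit zonal ones in [gegenbauerE]: the differential operator having them
    as eigenvectors is symmetric for the weight ([sphere_op_sym]). *)

(** * The Gegenbauer weight and its integrability *)

Section Weight.
Variable R : realType.
Notation leb := (@lebesgue_measure R).

(** For n = 2 the weight is unbounded at the ends of the interval, so the integrand
    is only continuous in the interior.  The indefinite integral is nevertheless
    continuous up to the ends, and the mean value theorem applies to its
    difference with the antiderivative. *)
Lemma improper_FTC (g G : R -> R) (a b : R) : a < b ->
  leb.-integrable `[a, b] (EFin \o g) ->
  (forall x, x \in `]a, b[ -> {for x, continuous g}) ->
  (forall x, x \in `]a, b[ -> is_derive x 1 G (g x)) ->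
  {within `[a, b], continuous G} ->
  \int[leb]_(t in `[a, b]) g t = G b - G a.
Proof.
move=> ab ig cg dG cG.
pose P x := parameterized_integral leb a x g.
have dP x : x \in `]a, b[ -> is_derive x 1 P (g x).
  move=> xab; have xb : x < b by move: xab; rewrite in_itv/= => /andP[].
  have ax : a < x by move: xab; rewrite in_itv/= => /andP[].
  have [d1 d2] := continuous_FTC1_closed xb ig ax (cg x xab).
  by apply: DeriveDef; [exact: d1 | rewrite -derive1E].
have cP : {within `[a, b], continuous P}.
  by apply: parameterized_integral_continuous => //; exact: ltW.
have [] := @MVT R (G \- P) (fun _ => 0) a b ab.
- move=> x xab; have d1 := dG x xab; have d2 := dP x xab.
  by apply: is_derive_eq (is_deriveB _ _) _; rewrite subrr.
- by move=> x; apply: cvgB; [exact: cG | exact: cP].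
- move=> c _; rewrite mul0r /= => /eqP.
  have Pa : P a = 0.
    by rewrite /P /parameterized_integral set_itv1 Rintegral_set1.
  rewrite Pa subr0 -[X in X = _]/(P b) => /eqP h.
  apply/eqP; rewrite eq_sym -subr_eq0; apply/eqP; lra.
Qed.

Definition gweight (n : nat) (t : R) : R := (1 - t ^+ 2) `^ ((n%:R - 3) / 2).

Lemma onem_sqr_gt0 (t : R) : t \in `]-1, 1[ -> 0 < 1 - t ^+ 2.
Proof.
rewrite in_itv/= => /andP[h1 h2].
by rewrite (_ : 1 - t ^+ 2 = (1 - t) * (1 + t)); [apply: mulr_gt0; lra|ring].
Qed.

Lemma is_derive_onem_sqr (t : R) :
  is_derive t 1 (fun t : R => 1 - t ^+ 2) (- (2 * t)).
Proof.
apply: is_derive_eq.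
by rewrite /GRing.scale /=; ring.
Qed.

Lemma is_derive_powR_onem_sqr (c t : R) : t \in `]-1, 1[ ->
  is_derive t 1 (fun t : R => (1 - t ^+ 2) `^ c)
    (- (2 * c * t) * (1 - t ^+ 2) `^ (c - 1)).
Proof.
move=> t1; have tp := onem_sqr_gt0 t1.
have d1 := is_derive_onem_sqr t.
have d2 := is_derive1_powR c tp.
have := @is_derive1_comp R (@powR R ^~ c) (fun t : R => 1 - t ^+ 2) t _ _ d2 d1.
rewrite /comp => d3; apply: is_derive_eq d3 _; ring.
Qed.

Lemma continuous_powR_onem_sqr (c t : R) : t \in `]-1, 1[ ->
  {for t, continuous (fun t : R => (1 - t ^+ 2) `^ c)}.
Proof.
move=> t1; apply/differentiable_continuous/derivable1_diffP.
by have [] := is_derive_powR_onem_sqr c t1.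
Qed.

Lemma measurable_gweight n (D : set R) : measurable_fun D (gweight n).
Proof.
apply: measurable_funTS.
apply: (@measurableT_comp _ _ _ _ _ _ (@powR R ^~ ((n%:R - 3) / 2))) => //.
by apply: measurable_funB => //; apply: measurable_funX.
Qed.

Lemma gweight_ge0 n t : 0 <= gweight n t.
Proof. exact: powR_ge0. Qed.

(** On compact subintervals the integral is a difference of values of the arc
    cosine, hence at most pi; monotone convergence exhausts the open interval. *)
Lemma integrable_gweight2 : leb.-integrable `[-1, 1] (EFin \o gweight 2).
Proof.
apply/integrableP; split; first by apply/measurable_EFinP; exact: measurable_gweight.
under eq_integral do rewrite /= ger0_norm ?gweight_ge0//.
rewrite integral_itv_bndoo; last by apply/measurable_EFinP; exact: measurable_gweight.
pose d (k : nat) : R := k.+2%:R^-1.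
pose F (k : nat) : set R := `[-1 + d k, 1 - d k]%classic.
have kpos (k : nat) : 0 < d k by rewrite invr_gt0.
have khalf (k : nat) : d k <= 2^-1.
  by rewrite lef_pV2 ?posrE// ler_nat.
have UF : `]-1, 1[%classic = \bigcup_k F k.
  apply/seteqP; split => x /=.
    rewrite in_itv/= => /andP[x1 x2].
    have [k _ hk] : \forall k \near \oo, d k < Num.min (x + 1) (1 - x) :> R.
      have p : 0 < Num.min (x + 1) (1 - x) by rewrite lt_min; apply/andP; split; [rewrite -ltrBlDr sub0r|rewrite subr_gt0].
      have := near_infty_natSinv_lt (PosNum p).
      move=> [K _ hK]; exists K => // k /= Kk.
      apply: le_lt_trans (hK k Kk).
      by rewrite lef_pV2 ?posrE// ler_nat.
    exists k => //; have := hk k (leqnn k).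
    rewrite lt_min => /andP[h1 h2].
    rewrite /F /= in_itv/=; apply/andP; split.
      lra. lra.
  move=> [k _]; rewrite /F/= !in_itv/= => /andP[h1 h2].
  by have := kpos k; move=> ?; apply/andP; split; lra.
rewrite UF.
have nnF : nondecreasing_seq F.
  move=> i j ij; rewrite subsetEset => x; rewrite /F/= !in_itv/= => /andP[h1 h2].
  have : d j <= d i by rewrite lef_pV2 ?posrE// ler_nat !ltnS.
  by move=> h; apply/andP; split; lra.
have cv := @ge0_nondecreasing_set_cvg_integral _ (measurableTypeR R) R F (EFin \o gweight 2) leb
  nnF (fun i => measurable_itv _)
  (fun i => (measurable_EFinP _ _).2 (@measurable_gweight 2 _))
  (fun i x _ => gweight_ge0 2 x).
apply: (@le_lt_trans _ _ pi%:E); last by rewrite ltry.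
rewrite -(cvg_lim _ cv)//.
apply: lime_le; first by apply/cvg_ex; eexists; exact: cv.
near=> k; rewrite /F.
have sub (x : R) : x \in `[-1 + d k, 1 - d k] -> x \in `]-1, 1[.
  have ? := kpos k.
  by rewrite !in_itv/= => /andP[h1 h2]; apply/andP; split; lra.
have suboo (x : R) : x \in `]-1 + d k, 1 - d k[ ->
    x \in `[-1 + d k, 1 - d k] by exact: subset_itv_oo_cc.
have lt1 : -1 + d k < 1 - d k :> R.
  by have := khalf k; have ? := kpos k; lra.
have cont : {within `[-1 + d k, 1 - d k], continuous (gweight 2)}.
  apply: continuous_in_subspaceT => x; rewrite inE => xF.
  by apply: continuous_powR_onem_sqr; apply: sub.
have dac (x : R) : x \in `]-1, 1[ -> is_derive x 1 (fun t : R => - acos t) (gweight 2 x).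
  move=> x1; have := x1; rewrite in_itv/= => x2.
  have da := is_derive1_acos x2.
  apply: is_derive_eq; rewrite opprK /gweight.
  rewrite (_ : (2%:R - 3) / 2 = - 2^-1); last by field.
  by rewrite powRN powR12_sqrt// ltW// onem_sqr_gt0.
have cac : {within `[-1 + d k, 1 - d k], continuous (fun t : R => - acos t)}.
  apply: derivable_within_continuous => x xF.
  by have [] := dac x (sub _ xF).
have := improper_FTC lt1 _ _ (fun x xF => dac x (sub _ (suboo _ xF))) cac.
have ic := continuous_compact_integrable (@segment_compact _ _ _) cont.
move=> /(_ ic) /(_ _) h.
rewrite -[leLHS]fineK; last exact: integrable_fin_num.
rewrite -[fine _]/(\int[leb]_(t in `[-1 + d k, 1 - d k]) gweight 2 t)%R.
rewrite h; last first.
  move=> x xF; apply: continuous_powR_onem_sqr; exact/sub/suboo.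
rewrite lee_fin.
have a1 : acos (-1 + d k) <= pi :> R.
  by apply: acos_lepi; have := khalf k; have ? := kpos k; move=> ?; apply/andP; split; lra.
have a2 : 0 <= acos (1 - d k) :> R.
  by apply: acos_ge0; have := khalf k; have ? := kpos k; move=> ?; apply/andP; split; lra.
lra.
Unshelve. all: by end_near. Qed.

End Weight.

(** * Integrating polynomials against the Gegenbauer weight *)

Lemma finite_roots (R : idomainType) (q : {poly R}) : q != 0 ->
  finite_set [set t | root q t].
Proof.
have [k] := ubnP (size q); elim: k q => // k IH q szq q0.
have [[a ra]|nr] := pselect (exists a, root q a); last first.
  by apply: (sub_finite_set _ (@finite_set0 R)) => t rt; apply: nr; exists t.
have /factor_theorem [r qE] := ra.
have r0 : r != 0 by apply: contraNneq q0 => r0; rewrite qE r0 mul0r.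
apply: (@sub_finite_set _ _ ([set a] `|` [set t | root r t])).
  move=> t /=; rewrite qE rootM root_XsubC => /orP[rt|/eqP ->]; [by right|by left].
rewrite finite_setU; split; first exact: finite_set1.
apply: IH => //; move: szq; rewrite qE size_Mmonic ?monicXsubC// size_XsubC.
by rewrite addn2 /= ltnS.
Qed.

Section GInt.
Variable R : realType.
Notation leb := (@lebesgue_measure R).
Variables (n : nat) (hn : (2 <= n)%N).

(** The base of the power lies in [0, 1] and the exponent is smallest for n = 2,
    which gives the domination in the interior; the added constant 1 covers the
    ends, where 0 to the power 0 is 1. *)
Lemma integrable_gweight : leb.-integrable `[-1, 1] (EFin \o @gweight R n).
Proof.
have i1 : leb.-integrable `[-1, 1] (EFin \o (fun t => gweight 2 t + 1 : R)).
  rewrite (_ : _ \o _ = (EFin \o gweight 2) \+ (EFin \o cst 1%R))%E; last first.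
    by apply/funext => x /=; rewrite EFinD.
  apply: integrableD => //; first exact: integrable_gweight2.
  apply: continuous_compact_integrable; first exact: segment_compact.
  by apply: continuous_subspaceT => x; exact: cvg_cst.
apply: le_integrable i1 => //.
  by apply/measurable_EFinP; exact: measurable_gweight.
move=> x /=; rewrite in_itv/= => /andP[x1 x2].
rewrite lee_fin !ger0_norm ?addr_ge0 ?gweight_ge0//.
have x3 : 0 <= 1 - x ^+ 2 <= 1.
  apply/andP; split; last by rewrite lerBlDr lerDl sqr_ge0.
  rewrite (_ : 1 - x ^+ 2 = (1 - x) * (1 + x)); [apply: mulr_ge0; lra|ring].
case/andP: x3; rewrite le_eqVlt => /predU1P[x0 _|x0 x4].
  rewrite /gweight -x0 ler_wpDl ?powR_ge0// /powR eqxx.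
  by case: (_ == 0); rewrite ?lexx ?ler01.
rewrite ler_wpDr// /gweight; apply: ger_powR; first by rewrite x0.
have : (2%:R : R) <= n%:R by rewrite ler_nat.
by move=> h; apply: ler_wpM2r; [rewrite invr_ge0|rewrite lerB].
Qed.

Lemma integrable_poly_gweight (q : {poly R}) :
  leb.-integrable `[-1, 1] (EFin \o (fun t => q.[t] * gweight n t)).
Proof.
have cq : {within `[-1, 1], continuous (fun t => q.[t])}.
  by apply: continuous_subspaceT => x; exact: continuous_horner.
have mq : measurable_fun `[-1, (1:R)] (fun t : R => q.[t]).
  exact: subspace_continuous_measurable_fun.
have [M hM] : exists M : R, forall t : R, t \in `[-1, 1] -> `|q.[t]| <= M.
  have [||c _ hc] := @EVT_max R (fun t : R => `|q.[t]|) (-1) 1.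
  - lra.
  - by move=> x; apply: cvg_norm; exact: cq.
  by exists `|q.[c]|.
have mI : measurable (`[-1, 1]%classic : set (measurableTypeR R)) by exact: measurable_itv.
have i1 := integrableZl mI M integrable_gweight.
apply: le_integrable i1 => //.
  by apply/measurable_EFinP; apply: measurable_funM => //; exact: measurable_gweight.
move=> x x1 /=; rewrite lee_fin !normrM.
apply: ler_wpM2r => //; apply: le_trans (hM x x1) (ler_norm _).
Qed.

(** The first argument records n >= 2, on which the linearity of the functional
    depends. *)
Definition gegenbauer_int (_ : (2 <= n)%N) (q : {poly R}) : R :=
  \int[leb]_(t in `[-1, 1]) (q.[t] * gweight n t).

Lemma gegenbauer_int_is_linear : scalar (gegenbauer_int hn).
Proof.
move=> a p q; rewrite /gegenbauer_int.
rewrite -RintegralZl//; last exact: integrable_poly_gweight.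
rewrite -RintegralD//.
- by apply: eq_Rintegral => t _; rewrite hornerD hornerZ; ring.
- rewrite (_ : _ \o _ = EFin \o (fun t => (a *: p).[t] * gweight n t)).
    exact: integrable_poly_gweight.
  by apply/funext => t /=; rewrite hornerZ mulrA.
- exact: integrable_poly_gweight.
Qed.

HB.instance Definition _ := GRing.isLinear.Build R {poly R} R _ (gegenbauer_int hn)
  gegenbauer_int_is_linear.

Lemma gegenbauer_int_ge0 (q : {poly R}) :
  (forall t, t \in `[-1, 1] -> 0 <= q.[t]) -> 0 <= gegenbauer_int hn q.
Proof.
move=> q0; apply: Rintegral_ge0 => t t1.
by rewrite mulr_ge0 ?gweight_ge0// q0.
Qed.

(** If the integral were 0, the integrand would vanish almost everywhere, whereas
    inside the interval it vanishes only at the finitely many roots of q. *)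
Lemma gegenbauer_int_gt0 (q : {poly R}) : q != 0 ->
  (forall t, t \in `[-1, 1] -> 0 <= q.[t]) -> 0 < gegenbauer_int hn q.
Proof.
move=> qn0 q0; rewrite lt_neqAle gegenbauer_int_ge0// andbT eq_sym; apply/eqP => i0.
have ip := integrable_poly_gweight q.
have e0 : (\int[leb]_(t in `[(-1)%R, 1%R]) `|(q.[t] * gweight n t)%:E| = 0)%E.
  transitivity (\int[leb]_(t in `[(-1)%R, 1%R]) (q.[t] * gweight n t)%:E)%E.
    apply: eq_integral => t; rewrite inE => t1.
    by rewrite /= ger0_norm// mulr_ge0 ?gweight_ge0 ?q0.
  rewrite -[LHS]fineK; last exact: integrable_fin_num.
  by congr (_%:E).
have mI : measurable (`[-1, 1]%classic : set (measurableTypeR R)) by exact: measurable_itv.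
have [N [mN N0 subN]] := (ae_eq_integral_abs _ mI
   (measurable_int leb ip)).1 e0.
pose Z := [set t : R | root q t].
have mZ0 : leb Z = 0%E.
  by apply: countable_lebesgue_measure0; apply: finite_set_countable; exact: finite_roots.
have mZ : measurable (Z : set (measurableTypeR R)).
  apply: countable_measurable; first by move=> t; exact: measurable_set1.
  by apply: finite_set_countable; exact: finite_roots.
(* A null set N and the roots of q would cover the interval. *)
have sub1 : `]-1, 1[%classic `<=` N `|` Z.
  move=> t t1; have [rt|rt] := boolP (root q t); first by right.
  left; apply: subN => /= /(_ (subset_itv_oo_cc t1)) [] /eqP.
  rewrite mulf_eq0 => /orP[/eqP h|]; first by move: rt; rewrite /root h eqxx.
  by rewrite gt_eqF// powR_gt0// onem_sqr_gt0.
have : (leb `](-1)%R, 1%R[%classic <= leb (N `|` Z))%E.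
  by apply: le_measure => //; rewrite inE//; exact: measurableU.
have NZ0 : leb (N `|` Z) = 0%E.
  apply/eqP; rewrite -measure_le0; apply: le_trans (measureU2 _ _ _) _ => //.
  by have := mZ0; rewrite /= N0 => ->; rewrite adde0.
rewrite NZ0 lebesgue_measure_itv/= lte_fin.
rewrite (_ : (-1 < 1 :> R) = true); last by lra.
by rewrite -EFinB lee_fin; lra.
Qed.

Lemma cvg_powR_onem_sqr (F : set_system R) (FF : Filter F) (c x0 : R) : 0 < c ->
  1 - x0 ^+ 2 = 0 -> F --> x0 -> (\forall t \near F, t \in `]-1, 1[) ->
  (1 - t ^+ 2) `^ c @[t --> F] --> (0 : R).
Proof.
move=> c0 x00 Fx Fin.
apply: (@cvg_comp _ _ _ (fun t : R => 1 - t ^+ 2) (@powR R ^~ c) F (0^'+)); last first.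
  exact: powR_cvg0.
have h : (1 - t ^+ 2) @[t --> F] --> (0 : R).
  rewrite -x00; apply: cvgB; first exact: cvg_cst.
  by rewrite expr2; apply: cvgM.
move=> A; rewrite /at_right /= => /h hA.
rewrite /= /nbhs /=; near=> t.
have t1 : t \in `]-1, 1[ by near: t.
have : 0 < 1 - t ^+ 2 by exact: onem_sqr_gt0.
by near: t; exact: hA.
Unshelve. all: by end_near. Qed.

(** The integrand is the derivative of (1 - t^2)^((n-1)/2) u(t), which vanishes at
    both ends.  All orthogonality relations below follow from this identity. *)
Lemma gegenbauer_int_by_parts (u : {poly R}) :
  gegenbauer_int hn ((1 - 'X^2) * u^`() - (n.-1%:R) *: ('X * u)) = 0.
Proof.
pose c : R := (n%:R - 3) / 2 + 1.
have c0 : 0 < c.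
  have : (2%:R : R) <= n%:R by rewrite ler_nat.
  by rewrite /c; lra.
have nE : n.-1%:R = 2 * c :> R.
  by rewrite -subn1 natrB ?(ltnW hn)// /c; field.
pose G (t : R) := (1 - t ^+ 2) `^ c * u.[t].
transitivity (G 1 - G (-1)); last first.
  rewrite /G expr2 mulr1 subrr expr2 mulrNN mulr1 subrr powR0 ?gt_eqF//.
  by rewrite !mul0r subrr.
apply: improper_FTC.
- lra.
- exact: integrable_poly_gweight.
- move=> t t1; apply: cvgM; first exact: continuous_horner.
  exact: continuous_powR_onem_sqr.
- move=> t t1; have d1 := is_derive_powR_onem_sqr c t1.
  have d2 := is_derive_poly u t.
  apply: is_derive_eq (is_deriveM d1 d2) _.
  rewrite !hornerE /gweight /GRing.scale /=.
  have tp := onem_sqr_gt0 t1.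
  rewrite (_ : c - 1 = (n%:R - 3) / 2); last by rewrite /c; lra.
  rewrite (_ : _ `^ c = (1 - t ^+ 2) * (1 - t ^+ 2) `^ ((n%:R - 3) / 2)).
    by rewrite nE; ring.
  rewrite /c powRD; last by apply/implyP => _; rewrite gt_eqF.
  by rewrite powRr1 ?ltW// mulrC.
- apply: derivable_oo_LRcontinuous_within; split.
  + move=> t t1; have d1 := is_derive_powR_onem_sqr c t1.
    apply: derivableM; first by case: d1.
    exact: derivable_horner.
  + rewrite /G expr2 mulrNN mulr1 subrr powR0 ?gt_eqF// mul0r.
    rewrite -(mul0r u.[-1]).
    apply: cvgM; last by apply: cvg_at_right_filter; exact: continuous_horner.
    apply: (@cvg_powR_onem_sqr _ _ c (-1)) => //; first by ring.
      by apply: cvg_at_right_filter; exact: cvg_id.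
    near=> t; rewrite in_itv/=; apply/andP; split.
      by near: t; exact: nbhs_right_gt.
    by near: t; apply: nbhs_right_lt; lra.
  + rewrite /G expr2 mulr1 subrr powR0 ?gt_eqF// mul0r.
    rewrite -(mul0r u.[1]).
    apply: cvgM; last by apply: cvg_at_left_filter; exact: continuous_horner.
    apply: (@cvg_powR_onem_sqr _ _ c 1) => //; first by ring.
      by apply: cvg_at_left_filter; exact: cvg_id.
    near=> t; rewrite in_itv/=; apply/andP; split.
      by near: t; apply: nbhs_left_gt; lra.
    by near: t; exact: nbhs_left_lt.
Unshelve. all: by end_near. Qed.

End GInt.

(** * Zonal polynomials *)

Section Zonal.
Variable R : realType.
Variables (n : nat) (hn : (2 <= n)%N).
Implicit Types (p q : {poly R}).

(** Coefficients of the even or odd solution of degree k of the Gegenbauer equation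
    (1 - t^2) p'' - (n - 1) t p' + k (k + n - 2) p = 0.  The same recursion makes
    the homogenisation of the solution harmonic on R^n. *)
Fixpoint zcoef (k d : nat) : R :=
  match d with
  | 0 => (~~ odd k)%:R
  | 1 => (odd k)%:R
  | (d'.+1).+1 => zcoef k d' * ((d'%:R - k%:R) * (d' + k + n - 2)%:R
      / ((d'.+2)%:R * (d'.+1)%:R))
  end.

Definition zonal k : {poly R} := \poly_(d < k.+1) zcoef k d.

Lemma zcoefSS k d : zcoef k d.+2 * ((d.+2)%:R * (d.+1)%:R) =
  zcoef k d * ((d%:R - k%:R) * (d + k + n - 2)%:R).
Proof. by rewrite /= -mulrA divfK// mulf_neq0. Qed.

Lemma nat_ind2 (P : nat -> Prop) : P 0%N -> P 1%N ->
  (forall d, P d -> P d.+2) -> forall d, P d.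
Proof.
move=> P0 P1 PS d; suff: P d /\ P d.+1 by case.
by elim: d => // d [h1 h2]; split => //; exact: PS.
Qed.

Lemma zcoef_parity k d : odd d != odd k -> zcoef k d = 0.
Proof.
elim/nat_ind2: d => [|| d IH] /=; try by case: (odd k).
by rewrite negbK => /IH ->; rewrite mul0r.
Qed.

(** The factor d - k of the recursion stops the coefficients at d = k; the other
    parity class is 0 from the start. *)
Lemma zcoef_gt k d : (k < d)%N -> zcoef k d = 0.
Proof.
move=> kd; rewrite -(subnK kd); elim/nat_ind2: (d - k.+1)%N => [||i IH].
- by rewrite add0n; apply: zcoef_parity => /=; case: (odd k).
- by rewrite add1n /= subrr mul0r mul0r mulr0.
- by rewrite !addSn /= IH mul0r.
Qed.

Lemma coef_zonal k d : (zonal k)`_d = zcoef k d.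
Proof. by rewrite coef_poly; case: ltnP => // h; rewrite zcoef_gt. Qed.

Lemma zcoef_neq0 k d : (d <= k)%N -> odd d = odd k -> zcoef k d != 0.
Proof.
elim/nat_ind2: d => [_ /= <-|_ /= <-|d IH dk /=]; rewrite ?oner_neq0//.
rewrite negbK => ok; rewrite mulf_neq0 ?IH//; first by apply: leq_trans dk; rewrite leqW.
rewrite mulf_neq0 ?invr_eq0 ?mulf_neq0//.
- by rewrite subr_eq0 eqr_nat ltn_eqF// ltnW.
- by rewrite pnatr_eq0; apply/eqP; move: hn dk; lia.
Qed.

Lemma size_zonal k : size (zonal k) = k.+1.
Proof. by rewrite size_poly_eq//= zcoef_neq0. Qed.

(** The Laplacian of the sphere on functions of the dot product with a fixed
    point. *)
Definition sphere_op (p : {poly R}) := (1 - 'X^2) * p^`()^`() - n.-1%:R *: ('X * p^`()).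

Lemma zonal_ode k : sphere_op (zonal k) = - (k * (k + n - 2))%:R *: zonal k.
Proof.
apply/polyP => d; rewrite /sphere_op mulrBl mul1r !(coefB, coefZ) coefXnM coefXM.
rewrite !coef_deriv !coef_zonal.
have h := zcoefSS k d.
have n2 : (n - 2)%:R = n%:R - 2 :> R by rewrite natrB.
have n1 : n.-1%:R = n%:R - 1 :> R by rewrite -subn1 natrB// ltnW.
have e1 : (d + k + n - 2)%:R = d%:R + k%:R + (n%:R - 2) :> R.
  by rewrite -addnBA// !natrD n2.
have e2 : (k * (k + n - 2))%:R = k%:R * (k%:R + (n%:R - 2)) :> R.
  by rewrite natrM -addnBA// natrD n2.
rewrite e1 in h; rewrite e2 n1.
have {}h : zcoef k d.+2 *+ d.+2 *+ d.+1 = zcoef k d *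
   ((d%:R - k%:R) * (d%:R + k%:R + (n%:R - 2))).
  by rewrite -h -(mulr_natr (_ *+ _)) -(mulr_natr (zcoef _ _)) mulrA.
rewrite h; case: d {h e1} => [|[|d]]//.
- by rewrite /=; ring.
- rewrite -[in LHS]mulr_natr /=; ring.
- rewrite (_ : (d.+2 - 2)%N = d) ?subn2//; move: (zcoef k d.+2) => z /=.
  ring.
Qed.

Local Notation I := (gegenbauer_int hn).

(** The difference of the two sides is a derivative: integrate by parts with
    u = p' q - p q'. *)
Lemma sphere_op_sym p q : I (sphere_op p * q) = I (p * sphere_op q).
Proof.
have := gegenbauer_int_by_parts hn (p^`() * q - p * q^`()).
set u := (X in gegenbauer_int hn X); move=> h.
apply/eqP; rewrite -subr_eq0 -raddfB /= -h; apply/eqP; congr (I _).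
rewrite /u /sphere_op !(derivB, derivM) -!mul_polyC; ring.
Qed.

Lemma sphere_opXn j : sphere_op 'X^j = (j * j.-1)%:R *: 'X^(j.-2) - (j * (j + n - 2))%:R *: 'X^j.
Proof.
rewrite /sphere_op; case: j => [|[|j]].
- by rewrite expr0 derivC deriv0 !mulr0 !mul0n !scale0r !scaler0.
- rewrite expr1 derivX derivC mulr0 sub0r muln0 scale0r sub0r mulr1.
  by rewrite mul1n add1n subSS subn1.
- rewrite derivXn derivMn derivXn /= -!mul_polyC.
  have n2 : (n - 2)%:R = n%:R - 2 :> {poly R} by rewrite natrB.
  have n1 : n.-1%:R = n%:R - 1 :> {poly R} by rewrite -subn1 natrB// ltnW.
  rewrite -addnBA// !polyC_natr !natrM natrD n2 n1.
  rewrite !exprS; move: ('X^j) => Y; ring.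
Qed.


(** The zonal polynomial is an eigenvector of a symmetric operator that acts on
    'X^j by another eigenvalue up to a multiple of 'X^(j-2).  Hence the integral
    against 'X^j is proportional to the one against 'X^(j-2), and both are 0. *)
Lemma gegenbauer_int_zonal_Xn k j : (j < k)%N -> I (zonal k * 'X^j) = 0.
Proof.
have [m] := ubnP j; elim: m j => // m IH j jm jk.
have := sphere_op_sym (zonal k) 'X^j.
rewrite zonal_ode sphere_opXn -scalerAl linearZ /= mulrBr -!scalerAr linearB !linearZ /=.
have -> : (j * j.-1)%:R * I (zonal k * 'X^(j.-2)) = 0.
  case: j jm jk => [|[|j]] jm jk; rewrite ?mul0n ?mul0r ?muln0 ?mul0r//.
  by rewrite IH ?mulr0//=; lia.
rewrite add0r; set a := (k * _)%N; set b := (j * _)%N; move: (I _) => v h.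
have {}h : - a%:R * v = b%:R * - v :> R by exact: h.
have : (a%:R - b%:R) * v = 0 by rewrite mulrBl -[a%:R * v]opprK -mulNr h; ring.
move/eqP; rewrite mulf_eq0 => /orP[|/eqP//].
rewrite subr_eq0 eqr_nat => /eqP; rewrite /a /b; move: hn jk; nia.
Qed.

Lemma gegenbauer_int_zonal k q : (size q <= k)%N -> I (zonal k * q) = 0.
Proof.
move=> sq; rewrite -[q]coefK poly_def mulr_sumr linear_sum /= big1// => i _.
by rewrite -scalerAr linearZ /= gegenbauer_int_zonal_Xn ?mulr0// (leq_trans (ltn_ord i)).
Qed.

(** If the polynomial vanished at 1 it would be ('X - 1) r with r of degree less
    than k; orthogonality to r contradicts the positivity of (1 - t) r(t)^2. *)
Lemma zonal1_neq0 k : (zonal k).[1] != 0.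
Proof.
apply/eqP => /rootP /factor_theorem [r zE].
have z0 : zonal k != 0 by rewrite -size_poly_eq0 size_zonal.
have r0 : r != 0 by apply: contraNneq z0 => r0; rewrite zE r0 mul0r.
have sr : (size r <= k)%N.
  have := size_zonal k; rewrite zE size_Mmonic ?monicXsubC// size_XsubC.
  by rewrite addn2 /= => -[->].
have := gegenbauer_int_zonal sr; rewrite zE.
have -> : r * ('X - 1%:P) * r = - ((1 - 'X) * r ^+ 2) by rewrite polyC1; ring.
rewrite raddfN /= => /eqP; rewrite oppr_eq0 gt_eqF//.
apply: gegenbauer_int_gt0.
  by rewrite mulf_neq0 ?expf_neq0// -opprB oppr_eq0 -polyC1 polyXsubC_eq0.
move=> t; rewrite in_itv/= => /andP[t1 t2].
rewrite hornerM horner_exp hornerD hornerN hornerX -polyC1 hornerC; apply: mulr_ge0; last exact: sqr_ge0.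
by rewrite subr_ge0.
Qed.

(** Cancelling the leading terms of two solutions leaves a polynomial that is
    orthogonal to itself; the value at 1 then fixes the factor. *)
Lemma gegenbauer_spec_uniq k p q : gegenbauer_spec n k p -> gegenbauer_spec n k q -> p = q.
Proof.
move=> [sp op p1] [sq oq q1].
have op' (r : {poly R}) : (size r <= k)%N -> I (p * r) = 0.
  by move=> sr; rewrite /gegenbauer_int -(op _ sr); apply: eq_Rintegral => t _; rewrite hornerM.
have oq' (r : {poly R}) : (size r <= k)%N -> I (q * r) = 0.
  by move=> sr; rewrite /gegenbauer_int -(oq _ sr); apply: eq_Rintegral => t _; rewrite hornerM.
have lq : lead_coef q != 0 by rewrite lead_coef_eq0 -size_poly_eq0 sq.
pose c := lead_coef p / lead_coef q.
pose r := p - c *: q.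
have sr : (size r <= k)%N.
  apply/leq_sizeP => j; rewrite leq_eqVlt => /predU1P[<-|kj].
    rewrite /r coefB coefZ /c !lead_coefE sp sq /= divfK ?subrr//.
    by move: lq; rewrite lead_coefE sq.
  by rewrite /r coefB coefZ !nth_default ?sp ?sq// mulr0 subr0.
have r0 : r = 0.
  apply/eqP/negP => /negP r0.
  suff : I (r ^+ 2) = 0.
    apply/eqP; rewrite gt_eqF// gegenbauer_int_gt0 ?expf_neq0// => t _.
    by rewrite hornerE sqr_ge0.
  by rewrite expr2 {1}/r mulrBl linearB /= -scalerAl linearZ /= op'// oq'// mulr0 subr0.
have pE : p = c *: q by apply/eqP; rewrite -subr_eq0 -/r r0.
suff c1 : c = 1 by rewrite pE c1 scale1r.
by have := p1; rewrite pE hornerZ q1 mulr1.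
Qed.

Definition nzonal k := (zonal k).[1]^-1 *: zonal k.

Lemma gegenbauerE k : gegenbauer R n k = nzonal k.
Proof.
have spec : gegenbauer_spec n k (nzonal k).
  split.
  - by rewrite size_scale ?invr_eq0 ?zonal1_neq0// size_zonal.
  - move=> q sq.
    have : I (nzonal k * q) = 0.
      by rewrite -scalerAl linearZ /= gegenbauer_int_zonal// mulr0.
    by rewrite /gegenbauer_int => <-; apply: eq_Rintegral => t _; rewrite hornerM.
  - by rewrite hornerZ mulVf// zonal1_neq0.
rewrite /gegenbauer; case: xgetP => [p _ sp|/(_ _ spec)//].
exact: gegenbauer_spec_uniq sp spec.
Qed.
End Zonal.

(** * The Fischer inner product *)

Section Fischer.
Variable R : realType.
Variable n : nat.
Implicit Types (p q : mpoly n R) (x y : 'rV[R]_n).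
Local Notation "p @_ m" := (mcoeff m p) (at level 2, m at level 2).
Local Notation "''Y_' i" := (mpolyX R (mnm1 i)) (at level 2, i at level 2).

Definition multi_fact (m : multinom n) : R := \prod_(i < n) ((m i)`!)%:R.

(** The apolar inner product, for which multiplication by a variable is adjoint to
    differentiation and squares are visibly nonnegative.  It is truncated to
    degrees below d so that its index set is finite and independent of the
    arguments. *)
Definition fischer d p q : R :=
  \sum_(m : bmultinom n d) multi_fact m * p@_m * q@_m.

Lemma fischer_suml d (I : Type) (r : seq I) (P : pred I) (F : I -> mpoly n R) q :
  fischer d (\sum_(i <- r | P i) F i) q = \sum_(i <- r | P i) fischer d (F i) q.
Proof.
rewrite /fischer exchange_big /=; apply: eq_bigr => m _.
by rewrite raddf_sum /= mulr_sumr mulr_suml.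
Qed.

Lemma fischerZl d c p q : fischer d (c *: p) q = c * fischer d p q.
Proof.
rewrite /fischer mulr_sumr; apply: eq_bigr => m _.
by rewrite mcoeffZ !mulrA (mulrC c).
Qed.

Lemma fischerC d p q : fischer d p q = fischer d q p.
Proof. by apply: eq_bigr => m _; rewrite -!mulrA (mulrC p@_m). Qed.

Lemma fischer0r d p : fischer d p 0 = 0.
Proof. by rewrite /fischer big1// => m _; rewrite mcoeff0 mulr0. Qed.

Lemma fischerX d a q :
  fischer d (mpolyX R a) q = if (mdeg a < d)%N then multi_fact a * q@_a else 0.
Proof.
rewrite /fischer; case: ifP => ad.
  rewrite (bigD1 (BMultinom ad)) //= mcoeffX eqxx mulr1 big1 ?addr0// => m ma.
  rewrite mcoeffX; case: eqP => [am|_]; last by rewrite mulr0 mul0r.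
  by case/eqP: ma; apply/val_inj; rewrite /= am.
rewrite big1// => m _; rewrite mcoeffX; case: eqP => [am|_]; last by rewrite mulr0 mul0r.
by have := bmdeg m; rewrite -am ad.
Qed.

Lemma multi_factU a i : multi_fact (mnm_add a (mnm1 i)) = multi_fact a * ((a i).+1)%:R.
Proof.
rewrite /multi_fact (bigD1 i)//= [in RHS](bigD1 i)//= mnmDE mnm1E eqxx addn1 factS natrM.
rewrite (eq_bigr (fun j => ((a j)`!)%:R)); first by ring.
by move=> j ji; rewrite mnmDE mnm1E eq_sym (negbTE ji) addn0.
Qed.

Lemma fischer_mulX d i p q : fischer d.+1 ('Y_i * p) q = fischer d p (mderiv i q).
Proof.
rewrite (mpolyE p) mulr_sumr !fischer_suml; apply: eq_bigr => a _.
rewrite -scalerAr !fischerZl -mpolyXD !fischerX mdegD mdeg1 add1n ltnS; case: ifP => // _.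
by rewrite mcoeff_mderiv addmC multi_factU -mulr_natr; ring.
Qed.

Definition lform x : mpoly n R := \sum_(i < n) x 0 i *: 'Y_i.
Definition nform : mpoly n R := \sum_(i < n) 'Y_i * 'Y_i.
Definition laplacian p : mpoly n R := \sum_(i < n) mderiv i (mderiv i p).
Definition dir_deriv y p : mpoly n R := \sum_(i < n) y 0 i *: mderiv i p.
Definition ev y p : R := meval (fun i => y 0 i) p.

Lemma fischer_nform d p q : fischer d.+2 (nform * p) q = fischer d p (laplacian q).
Proof.
rewrite /nform mulr_suml fischer_suml [RHS]fischerC /laplacian fischer_suml.
by apply: eq_bigr => i _; rewrite -mulrA !fischer_mulX fischerC.
Qed.

Lemma fischer_lform d y p q : fischer d.+1 (lform y * p) q = fischer d p (dir_deriv y q).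
Proof.
rewrite /lform mulr_suml fischer_suml [RHS]fischerC /dir_deriv fischer_suml.
by apply: eq_bigr => i _; rewrite -scalerAl !fischerZl fischer_mulX fischerC.
Qed.

Definition homog (k : nat) p := forall m, mdeg m != k -> p@_m = 0.

Lemma homog_dir_deriv k y p : homog k.+1 p -> homog k (dir_deriv y p).
Proof.
move=> hp m mk; rewrite /dir_deriv raddf_sum /= big1// => i _.
by rewrite mcoeffZ mcoeff_mderiv hp ?mul0rn ?mulr0// mdegD mdeg1 addn1 eqSS.
Qed.

Lemma ev_dir_derivX y a :
  ev y (dir_deriv y (mpolyX R a)) = (mdeg a)%:R * ev y (mpolyX R a).
Proof.
rewrite /ev /dir_deriv raddf_sum /= mevalX mdegE natr_sum mulr_suml.
apply: eq_bigr => i _; rewrite mevalZ mderivX mevalZ mevalX.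
have [->|ai] := eqVneq (a i) 0%N; first by rewrite !mul0r !mulr0.
rewrite (bigD1 i)//= [in RHS](bigD1 i)//= mnmBE mnm1E eqxx.
rewrite (eq_bigr (fun j => y 0 j ^+ a j)); last first.
  by move=> j ji; rewrite mnmBE mnm1E eq_sym (negbTE ji) subn0.
by case: (a i) ai => // b _; rewrite subn1 /= exprS; ring.
Qed.

(** Euler's identity. *)
Lemma ev_dir_deriv k y p : homog k p -> ev y (dir_deriv y p) = k%:R * ev y p.
Proof.
move=> hp.
have -> : dir_deriv y p = \sum_(a <- msupp p) p@_a *: dir_deriv y (mpolyX R a).
  rewrite {1}(mpolyE p) /dir_deriv; under [RHS]eq_bigr do rewrite scaler_sumr.
  rewrite exchange_big /=; apply: eq_bigr => i _.
  rewrite (linear_sum (mderiv i)) /= scaler_sumr; apply: eq_bigr => a _.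
  by rewrite mderivZ !scalerA mulrC.
rewrite [in RHS](mpolyE p) /ev !(raddf_sum (meval _)) mulr_sumr /=.
rewrite big_seq [RHS]big_seq; apply: eq_bigr => a; rewrite mcoeff_msupp => pa.
have ak : mdeg a = k by apply/eqP/negPn/negP => /hp h; rewrite h eqxx in pa.
by rewrite !mevalZ -[meval _ (dir_deriv _ _)]/(ev _ _) ev_dir_derivX ak mulrCA.
Qed.

(** Powers of a linear form reproduce values: move the k linear factors to the
    other side one at a time and apply Euler's identity at each step. *)
Lemma fischer_lformX k y q : homog k q -> fischer k.+1 (lform y ^+ k) q = (k`!)%:R * ev y q.
Proof.
elim: k q => [|k IH] q hq.
  rewrite expr0 -mpolyX0 fischerX mdeg0 /= fact0 mul1r.
  have -> : multi_fact mnm0 = 1 by rewrite /multi_fact big1// => i _; rewrite mnm0E.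
  rewrite mul1r /ev; have -> : q = mpolyC n q@_mnm0.
    apply/mpolyP => m; rewrite mcoeffC; case: eqP => [->|/eqP m0]; first by rewrite mulr1.
    by rewrite mulr0 hq// mdeg_eq0.
  by rewrite mevalC mcoeffC eqxx mulr1.
rewrite exprS fischer_lform IH; last exact: homog_dir_deriv.
by rewrite (ev_dir_deriv y hq) factS natrM; ring.
Qed.

Lemma homogM j k p q : homog j p -> homog k q -> homog (j + k) (p * q).
Proof.
move=> hp hq m mjk; rewrite mcoeffM big1// => -[a b] /= /eqP mab.
have [aj|aj] := eqVneq (mdeg a) j; last by rewrite hp ?mul0r.
rewrite [X in _ * X]hq ?mulr0//; apply: contraNneq mjk => bk.
by rewrite mab mdegD aj bk.
Qed.

Lemma homogX j k p : homog j p -> homog (k * j) (p ^+ k).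
Proof.
move=> hp; elim: k => [|k IH]; last by rewrite exprS mulSn; exact: homogM.
by move=> m m0; rewrite expr0 mcoeff1 -mdeg_eq0 (negbTE m0).
Qed.

Lemma homogZ k c p : homog k p -> homog k (c *: p).
Proof. by move=> hp m mk; rewrite mcoeffZ hp// mulr0. Qed.

Lemma homog_sum k (I : Type) (r : seq I) (P : pred I) (F : I -> mpoly n R) :
  (forall i, P i -> homog k (F i)) -> homog k (\sum_(i <- r | P i) F i).
Proof.
move=> hF m mk; rewrite raddf_sum /= big1// => i Pi; exact: hF.
Qed.

Lemma homogY i : homog 1 ('Y_i).
Proof.
move=> m m1; rewrite mcoeffX; case: eqP => // mi.
by rewrite -mi mdeg1 eqxx in m1.
Qed.

Lemma homog_lform x : homog 1 (lform x).
Proof. by apply: homog_sum => i _; apply/homogZ/homogY. Qed.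

Lemma homog_nform : homog 2 nform.
Proof. by apply: homog_sum => i _; apply: (@homogM 1 1); exact: homogY. Qed.

Lemma ev_lform x y : ev y (lform x) = dot x y.
Proof.
rewrite /ev /lform raddf_sum /=; apply: eq_bigr => i _.
by rewrite mevalZ mevalXU.
Qed.

Lemma ev_nform y : ev y nform = dot y y.
Proof.
rewrite /ev /nform raddf_sum /=; apply: eq_bigr => i _.
by rewrite mevalM mevalXU.
Qed.

Lemma mderivXn i p k : mderiv i (p ^+ k) = k%:R *: (p ^+ k.-1 * mderiv i p).
Proof.
elim: k => [|k IH]; first by rewrite expr0 scale0r -mpolyC1 mderivC.
rewrite exprS mderivM IH -!mul_mpolyC !mpolyC_nat.
by case: k {IH} => [|k] /=; rewrite ?expr0 ?exprS; ring.
Qed.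

Lemma mderivY (i j : 'I_n) : mderiv i ('Y_j) = (i == j)%:R.
Proof.
rewrite mderivX mnm1E eq_sym; case: eqP => [->|_]; last by rewrite scale0r.
have -> : mnm_sub (mnm1 j) (mnm1 j) = mnm0 by apply/mnmP => a; rewrite !mnmE subnn.
by rewrite mpolyX0 scale1r.
Qed.

Lemma mderiv_lform i x : mderiv i (lform x) = mpolyC n (x 0 i).
Proof.
rewrite /lform raddf_sum /= (bigD1 i)//= big1 ?addr0.
  by rewrite mderivZ mderivY eqxx -mul_mpolyC mulr1.
by move=> j ji; rewrite mderivZ mderivY eq_sym (negbTE ji) scaler0.
Qed.

Lemma mderiv_nform i : mderiv i nform = 2%:R *: 'Y_i.
Proof.
rewrite /nform raddf_sum /= (bigD1 i)//= big1 ?addr0.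
  by rewrite mderivM mderivY eqxx mul1r mulr1 scaler_nat.
by move=> j ji; rewrite mderivM mderivY eq_sym (negbTE ji) mul0r mulr0 addr0.
Qed.

Lemma laplacian_nform_lform x j d : dot x x = 1 ->
  laplacian (nform ^+ j * lform x ^+ d) =
  ((2 * j * (n + 2 * j.-1 + 2 * d))%:R) *: (nform ^+ j.-1 * lform x ^+ d) +
  ((d * d.-1)%:R) *: (nform ^+ j * lform x ^+ d.-2).
Proof.
move=> x1; pose Nf := nform; pose L := lform x.
rewrite /laplacian (eq_bigr (fun i => (2 * j)%:R *: (Nf ^+ j.-1 * L ^+ d) +
   (4 * j * j.-1)%:R *: (Nf ^+ j.-2 * L ^+ d * ('Y_i * 'Y_i)) +
   (4 * j * d)%:R *: (Nf ^+ j.-1 * L ^+ d.-1 * (x 0 i *: 'Y_i)) +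
   (d * d.-1)%:R *: (Nf ^+ j * L ^+ d.-2 * mpolyC n (x 0 i * x 0 i)))); last first.
  move=> i _.
  rewrite !(mderivM, mderivD, mderivXn, mderivZ, mderiv_nform, mderiv_lform, mderivC, mderivY).
  rewrite -/Nf -/L eqxx mulr1n -!mul_mpolyC !(mpolyC_nat, natrM, mpolyCM).
  move: (Nf ^+ _) (Nf ^+ _) (Nf ^+ _) (L ^+ _) (L ^+ _) (L ^+ _) => *.
  ring.
rewrite !big_split /= sumr_const card_ord -!scaler_sumr -!mulr_sumr -/(lform x) -/nform.
rewrite -(raddf_sum (@mpolyC n R)) /= -/(dot x x) x1 -/Nf -/L.
have -> : (4 * j * j.-1)%:R *: (Nf ^+ j.-2 * L ^+ d * Nf) =
          (4 * j * j.-1)%:R *: (Nf ^+ j.-1 * L ^+ d).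
  case: j => [|[|j]]; rewrite ?muln0 ?scale0r//=.
  by rewrite [in RHS]exprS; congr (_ *: _); ring.
have -> : (4 * j * d)%:R *: (Nf ^+ j.-1 * L ^+ d.-1 * L) =
          (4 * j * d)%:R *: (Nf ^+ j.-1 * L ^+ d).
  case: d => [|d]; rewrite ?muln0 ?scale0r//=.
  by rewrite [in RHS]exprS; congr (_ *: _); ring.
rewrite mpolyC1 -!mul_mpolyC !(mpolyC_nat, natrM, natrD) mulr1.
 ring.
Qed.
End Fischer.

(** * Zonal harmonics and positive semidefinite kernels *)

Section Zharm.
Variable R : realType.
Variables (n : nat) (hn : (2 <= n)%N).
Implicit Types (p q : mpoly n R) (x y : 'rV[R]_n).
Notation zc := (zcoef R n).

(** The harmonic homogenisation of the zonal polynomial centred at x.  When k - d is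
    odd the coefficient is 0, so halving k - d is exact wherever it matters. *)
Definition zonal_harm k x : mpoly n R :=
  \sum_(d < k.+1) zc k d *: (nform R n ^+ (k - d)./2 * lform x ^+ d).

Lemma zcoef_half k d : (d <= k)%N -> zc k d != 0 -> (2 * (k - d)./2)%N = (k - d)%N.
Proof.
move=> dk zd; have /eqP pk : odd d == odd k.
  by apply: contraNT zd => h; rewrite zcoef_parity.
by have := odd_double_half (k - d); rewrite oddB// pk addbb add0n mul2n.
Qed.

(** The Laplacian of the term of index d contributes to the monomials of indices d
    and d - 2; the recursion between the coefficients makes the sum telescope. *)
Lemma laplacian_zonal_harm k x : dot x x = 1 -> laplacian (zonal_harm k x) = 0.
Proof.
move=> x1; pose Nf := nform R n; pose L := lform x.
have laplS : laplacian (zonal_harm k x) = \sum_(d < k.+1) zc k d *: laplacian (Nf ^+ (k - d)./2 * L ^+ d).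
  rewrite /laplacian; under [RHS]eq_bigr do rewrite scaler_sumr.
  rewrite exchange_big /=. apply: eq_bigr => i _.
  have -> : mderiv i (zonal_harm k x) =
      \sum_(d < k.+1) zc k d *: mderiv i (Nf ^+ (k - d)./2 * L ^+ d).
    by rewrite /zonal_harm (linear_sum (mderiv i)); apply: eq_bigr => d _; rewrite /= mderivZ.
  by rewrite (linear_sum (mderiv i)); apply: eq_bigr => d _; rewrite /= mderivZ.
pose A d := (zc k d * ((k - d) * (n + k + d - 2))%:R) *: (Nf ^+ ((k - d)./2).-1 * L ^+ d).
pose B d := (zc k d * (d * d.-1)%:R) *: (Nf ^+ (k - d)./2 * L ^+ d.-2).
have -> : laplacian (zonal_harm k x) = \sum_(d < k.+1) A d + \sum_(d < k.+1) B d.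
  rewrite laplS -big_split. apply: eq_bigr => -[d dk] _ /=.
  rewrite laplacian_nform_lform// scalerDr /A /B !scalerA; congr (_ + _).
  have [->|zd] := eqVneq (zc k d) 0; first by rewrite !mul0r.
  congr (_ *: _); congr (_ * _%:R).
  have := zcoef_half (ltnSE dk) zd; have := ltnSE dk; move: hn.
  move: (_./2) => h; case: (posnP h) => [->|]; nia.
have B0 d : (k < d)%N -> B d = 0 by move=> kd; rewrite /B zcoef_gt// mul0r scale0r.
have -> : \sum_(d < k.+1) B d = \sum_(d < k.+1) B d.+2.
  have -> : \sum_(d < k.+1) B d = \sum_(d < k.+3) B d.
    by rewrite [RHS]big_ord_recr [in RHS]big_ord_recr /= !B0 ?addr0// ltnW.
  rewrite [LHS]big_ord_recl [in LHS]big_ord_recl /=.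
  have -> : B 0%N = 0 by rewrite /B mul0n mulr0 scale0r.
  have -> : B (bump 0 0) = 0 by rewrite /B muln0 mulr0 scale0r.
  by rewrite !add0r; apply: eq_bigr => d _.
rewrite -big_split big1// => -[d dk] _; rewrite /A /B /=.
have -> : (k - d.+2)./2 = ((k - d)./2).-1 by lia.
have -> : zc k d.+2 * (d.+2 * d.+1)%:R = - (zc k d * ((k - d) * (n + k + d - 2))%:R).
  have dk' := ltnSE dk.
  rewrite natrM zcoefSS natrM (natrB _ dk') (_ : (n + k + d - 2 = d + k + n - 2)%N); last by lia.
  by ring.
by rewrite -scalerDl addrN scale0r.
Qed.

Lemma homog_zonal_harm k x : homog k (zonal_harm k x).
Proof.
move=> m mk; rewrite /zonal_harm raddf_sum /= big1// => -[d dk] _ /=.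
have [->|zd] := eqVneq (zc k d) 0; first by rewrite scale0r mcoeff0.
apply: (@homogZ _ _ k) => //.
have := homogM (homogX (k := (k - d)./2) (@homog_nform R n)) (homogX (k := d) (homog_lform x)).
have dk' := ltnSE dk.
by rewrite [in X in homog X]mulnC zcoef_half// muln1 subnK.
Qed.

Lemma ev_zonal_harm k x y : dot y y = 1 -> ev y (zonal_harm k x) = (zonal R n k).[dot x y].
Proof.
move=> y1; rewrite /ev /zonal_harm raddf_sum /= horner_poly; apply: eq_bigr => d _.
rewrite mevalZ mevalM !rmorphXn /= -!/(ev y _) ev_lform ev_nform y1.
by rewrite expr1n mul1r.
Qed.

(** All terms of the left argument but the top one are multiples of the norm form,
    which is adjoint to the Laplacian, so harmonicity of the right argument
    leaves only the reproducing power of the linear form. *)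
Lemma fischer_zonal_harm k x y : dot x x = 1 -> dot y y = 1 ->
  fischer k.+1 (zonal_harm k y) (zonal_harm k x) = zc k k * (k`!)%:R * (zonal R n k).[dot x y].
Proof.
move=> x1 y1; rewrite {1}/zonal_harm fischer_suml big_ord_recr /= big1 ?add0r.
  rewrite fischerZl subnn expr0 mul1r fischer_lformX; last exact: homog_zonal_harm.
  by rewrite ev_zonal_harm// mulrA.
move=> [d dk] _ /=; rewrite fischerZl.
have [->|zd] := eqVneq (zc k d) 0; first by rewrite mul0r.
have dk' : (d <= k)%N by exact: ltnW.
have := zcoef_half dk' zd; case: (_./2) => [|h] hE; first by lia.
have [k' kE] : exists k', k.+1 = k'.+2 by exists k.-1; lia.
by rewrite kE exprS -mulrA fischer_nform laplacian_zonal_harm// fischer0r mulr0.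
Qed.

(** Continuity of each coefficient passes to products because a coefficient of a
    product is a finite sum over an index set fixed in advance. *)
Definition coef_cont (F : 'rV[R]_n -> mpoly n R) := forall m, continuous (fun x => mcoeff m (F x)).

Lemma coef_cont_cst p : coef_cont (fun=> p).
Proof. by move=> m; exact: cst_continuous. Qed.

Lemma continuous_sum (T : topologicalType) (I : Type) (r : seq I) (P : pred I)
    (F : I -> T -> R) : (forall i, P i -> continuous (F i)) ->
  continuous (fun z : T => \sum_(i <- r | P i) F i z).
Proof.
move=> cF z; elim: r => [|i r IH].
  by under eq_fun do rewrite big_nil; exact: cvg_cst.
under eq_fun do rewrite big_cons.
by case: ifP => // Pi; apply: cvgD => //; exact: cF.
Qed.

Lemma coef_cont_sum (I : Type) (r : seq I) (P : pred I) (F : I -> 'rV[R]_n -> mpoly n R) :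
  (forall i, coef_cont (F i)) -> coef_cont (fun x => \sum_(i <- r | P i) F i x).
Proof.
move=> cF m; under eq_fun do rewrite raddf_sum /=.
by apply: continuous_sum => i _; exact: cF.
Qed.

Lemma coef_contM F G : coef_cont F -> coef_cont G -> coef_cont (fun x => F x * G x).
Proof.
move=> cF cG m; under eq_fun do rewrite mcoeffM.
apply: continuous_sum => i _ x; apply: (@continuousM _ _ (fun z => mcoeff i.1 (F z)) (fun z => mcoeff i.2 (G z))); [exact: cF|exact: cG].
Qed.

Lemma coef_contX F k : coef_cont F -> coef_cont (fun x => F x ^+ k).
Proof.
move=> cF; elim: k => [|k IH]; first exact: coef_cont_cst.
by under [F in coef_cont F]eq_fun do rewrite exprS; exact: coef_contM.
Qed.

Lemma coef_contZ F c : coef_cont F -> coef_cont (fun x => c *: F x).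
Proof.
move=> cF m; under eq_fun do rewrite mcoeffZ.
move=> x; apply: (@continuousM _ _ (fun=> c) (fun z => mcoeff m (F z))); [exact: cst_continuous|exact: cF].
Qed.

Lemma coef_cont_zonal_harm k : coef_cont (zonal_harm k).
Proof.
apply: coef_cont_sum => d; apply/coef_contZ/coef_contM; first exact: coef_cont_cst.
apply: coef_contX; apply: coef_cont_sum => i m.
under eq_fun do rewrite mcoeffZ.
move=> x; apply: (@continuousM _ _ (fun z : 'rV[R]_n => z 0 i) (fun=> _)); [exact: coord_continuous|exact: cst_continuous].
Qed.

End Zharm.

Section PSD.
Variable R : realType.
Variable n : nat.
Implicit Types (q : {poly R}).

(** Positive semidefiniteness of the kernel q(x . y), witnessed by finitely many
    continuous features.  In this form the kernel integrates term by term
    against any measure, and pairing features multiplies kernels. *)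
Definition psd_kernel q := exists (J : finType) (phi : J -> 'rV[R]_n -> R),
  (forall j, continuous (phi j)) /\
  forall x y, dot x x = 1 -> dot y y = 1 ->
    q.[dot x y] = \sum_j phi j x * phi j y.

Lemma psdC c : 0 <= c -> psd_kernel c%:P.
Proof.
move=> c0; exists unit, (fun _ _ => Num.sqrt c); split.
  by move=> _; exact: cst_continuous.
by move=> x y _ _; rewrite hornerC big_const card_unit /= addr0 -expr2 sqr_sqrtr.
Qed.

Lemma psdX : psd_kernel 'X.
Proof.
exists 'I_n, (fun i x => x 0 i); split; first by move=> i; exact: coord_continuous.
by move=> x y _ _; rewrite hornerX.
Qed.

Lemma psdD p q : psd_kernel p -> psd_kernel q -> psd_kernel (p + q).
Proof.
move=> [J [f [cf fE]]] [K [g [cg gE]]].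
exists (J + K)%type, (fun jk => match jk with inl j => f j | inr k => g k end); split.
  by case.
by move=> x y x1 y1; rewrite hornerD big_sumType /= -fE// -gE.
Qed.

Lemma psdM p q : psd_kernel p -> psd_kernel q -> psd_kernel (p * q).
Proof.
move=> [J [f [cf fE]]] [K [g [cg gE]]].
exists (J * K)%type, (fun jk x => f jk.1 x * g jk.2 x); split.
  move=> jk x; apply: (@continuousM _ _ (f jk.1) (g jk.2)); [exact: cf|exact: cg].
move=> x y x1 y1; rewrite hornerM fE// gE// big_distrlr pair_big /=.
by apply: eq_bigr => jk _; ring.
Qed.

Lemma psdZ c p : 0 <= c -> psd_kernel p -> psd_kernel (c *: p).
Proof. by move=> c0 pp; rewrite -mul_polyC; apply: psdM => //; exact: psdC. Qed.

Lemma multi_fact_gt0 (m : multinom n) : 0 < multi_fact R m :> R.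
Proof. by apply: prodr_gt0 => i _; rewrite ltr0n fact_gt0. Qed.

(** By the reproducing formula the kernel is a multiple of the Fischer product of
    two zonal harmonics.  The sign of the factor is read off at x = y. *)
Lemma psd_zonal (hn : (2 <= n)%N) k : psd_kernel (nzonal R n k).
Proof.
pose c := zcoef R n k k * (k`!)%:R.
have [x x1] : exists x : 'rV[R]_n, dot x x = 1.
  have [x hx] := point : sphere R hn.
  by exists x; move: hx; rewrite inE.
have ge0 (x0 : 'rV[R]_n) : 0 <= fischer k.+1 (zonal_harm k x0) (zonal_harm k x0).
  apply: sumr_ge0 => m _; rewrite -mulrA; apply: mulr_ge0.
    exact/ltW/multi_fact_gt0.
  by rewrite -expr2; exact: sqr_ge0.
(* At x = y the reproducing formula reads <H_x, H_x> = c * zonal(1). *)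
have c0 : 0 < c * (zonal R n k).[1].
  rewrite lt_neqAle; apply/andP; split.
    by rewrite eq_sym mulf_neq0 ?zonal1_neq0// /c mulf_neq0 ?zcoef_neq0.
  by have := ge0 x; rewrite fischer_zonal_harm// x1.
exists (bmultinom n k.+1), (fun (m : bmultinom n k.+1) (x : 'rV[R]_n) => Num.sqrt (multi_fact R m / (c * (zonal R n k).[1])) *
    mcoeff m (zonal_harm k x)); split.
  move=> m z; apply: (@continuousM _ _ (fun=> _) (fun z => mcoeff m (zonal_harm k z))); [exact: cst_continuous|exact: coef_cont_zonal_harm].
move=> y z y1 z1; rewrite hornerZ.
transitivity ((c * (zonal R n k).[1])^-1 * fischer k.+1 (zonal_harm k y) (zonal_harm k z)).
  rewrite fischer_zonal_harm// (_ : dot z y = dot y z); last first.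
    by apply: eq_bigr => i _; rewrite mulrC.
  rewrite -/c; have h := zonal1_neq0 R hn k.
  have c1 : c != 0 by apply: contraTneq c0 => ->; rewrite mul0r ltxx.
  by field; rewrite h c1.
rewrite mulr_sumr; apply: eq_bigr => m _.
rewrite mulrACA -expr2 sqr_sqrtr; first by ring.
by apply: divr_ge0; apply: ltW => //; exact: multi_fact_gt0.
Qed.
End PSD.

(** * Prefix products and discrete orthogonal polynomials *)

Section OrthogonalPolynomials.
Variable R : realFieldType.
Implicit Types (p q r : {poly R}).

Lemma poly_triangular_span (P : nat -> {poly R}) i q :
  (forall l, (l < i)%N -> size (P l) = l.+1) -> (size q <= i)%N ->
  exists e : nat -> R, q = \sum_(l < i) e l *: P l.
Proof.
elim: i q => [|i IH] q sP sq.
  exists (fun=> 0); rewrite big_ord0; apply/eqP.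
  by rewrite -size_poly_eq0 -leqn0.
pose c := q`_i / lead_coef (P i).
have sPi := sP i (ltnSn i).
have l0 : lead_coef (P i) != 0 by rewrite lead_coef_eq0 -size_poly_eq0 sPi.
have sr : (size (q - c *: P i)%R <= i)%N.
  apply/leq_sizeP => j; rewrite leq_eqVlt => /predU1P[<-|ij].
    by move: l0; rewrite /c !lead_coefE sPi coefB coefZ /= => l0; rewrite divfK// subrr.
  by rewrite coefB coefZ !nth_default ?sPi// ?mulr0 ?subr0// (leq_trans sq).
have [e qE] := IH _ (fun l li => sP l (ltnW li)) sr.
exists (fun l => if l == i then c else e l); rewrite big_ord_recr /= eqxx.
rewrite (eq_bigr (fun l : 'I_i => e l *: P l)); last by move=> l _; rewrite ltn_eqF.
by rewrite -qE subrK.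
Qed.

Definition isOP (L : {poly R} -> R) i p :=
  [/\ p \is monic, size p = i.+1 & forall q, (size q <= i)%N -> L (p * q) = 0].

Definition posdef (L : {poly R} -> R) k :=
  forall q, q != 0 -> (size q <= k)%N -> 0 < L (q ^+ 2).

Lemma isOP_neq0 L i p : isOP L i p -> p != 0.
Proof. by case=> /monic_neq0. Qed.

Lemma size_monicB i p q : p \is monic -> q \is monic ->
  size p = i.+1 -> size q = i.+1 -> (size (p - q)%R <= i)%N.
Proof.
move=> mp mq sp sq; apply/leq_sizeP => j; rewrite leq_eqVlt => /predU1P[<-|ij].
  by have := monicP mp; have := monicP mq; rewrite !lead_coefE sp sq coefB /= => -> ->; rewrite subrr.
by rewrite coefB !nth_default ?sp ?sq// subrr.
Qed.

Section Functional.
Variables (L : {scalar {poly R}}) (k : nat).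
Hypothesis Lpos : posdef L k.

Lemma isOP_mul i p q : isOP L i p -> q \is monic -> size q = i.+1 ->
  L (p * q) = L (p ^+ 2).
Proof.
move=> [mp sp op] mq sq; apply/eqP; rewrite -subr_eq0 -linearB expr2 /= -mulrBr.
by rewrite op// size_monicB.
Qed.

(** Gram-Schmidt orthogonalisation of 'X^j. *)
Lemma isOP_exists i : (i <= k)%N -> exists p, isOP L i p.
Proof.
move=> ik; suff [P hP] : exists P : nat -> {poly R}, forall l, (l < i.+1)%N -> isOP L l (P l).
  by exists (P i); exact: hP.
elim: {-2}i.+1 (leqnn i.+1) ik => [_ _|j IH ji ik]; first by exists (fun=> 0).
have [P hP] := IH (ltnW ji) ik.
pose c l := L ('X^j * P l) / L (P l ^+ 2).
pose u := \sum_(l < j) c l *: P l.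
have su : (size u <= j)%N.
  apply: (leq_trans (size_sum _ _ _)); apply/bigmax_leqP => l _.
  by apply: leq_trans (size_scale_leq _ _) _; have [_ -> _] := hP l (ltn_ord l).
exists (fun l => if l == j then 'X^j - u else P l) => l lj.
case: eqP lj => [->|/eqP lj] lj'; last by apply: hP; rewrite ltn_neqAle lj.
have sX : size ('X^j - u) = j.+1.
  by rewrite size_polyDl size_polyXn// size_polyN ltnS.
split=> //.
  by rewrite monicE lead_coefDl ?lead_coefXn// size_polyXn size_polyN ltnS.
have oP (a : nat) : (a < j)%N -> L (('X^j - u) * P a) = 0.
  move=> aj; rewrite mulrBl linearB /= mulr_suml linear_sum /= (bigD1 (Ordinal aj))//=.
  rewrite big1 ?addr0 => [|b ba]; rewrite -scalerAl linearZ /=.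
    rewrite -expr2 divfK ?subrr// gt_eqF//; apply: Lpos; first exact: isOP_neq0 (hP a aj).
    by have [_ -> _] := hP a aj; apply: leq_trans aj _; apply: leq_trans ik.
  have /eqP ba' : nat_of_ord b != a by [].
  have [_ sa oa] := hP a aj; have [_ sb ob] := hP b (ltn_ord b).
  have [h|h|//] := ltngtP b a; first by rewrite (mulrC (P b)) oa ?mulr0// sb.
  by rewrite ob ?mulr0// sa.
move=> q sq; have [e ->] := @poly_triangular_span P j q
  (fun l lj => let: And3 _ s _ := hP l lj in s) sq.
rewrite mulr_sumr linear_sum /= big1// => a _.
by rewrite -scalerAr linearZ /= oP// mulr0.
Qed.

Lemma isOP_expand i (P : nat -> {poly R}) q : (i <= k)%N ->
  (forall l, (l < i)%N -> isOP L l (P l)) -> (size q <= i)%N ->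
  q = \sum_(l < i) (L (q * P l) / L (P l ^+ 2)) *: P l.
Proof.
move=> ik hP sq; have [e qE] := @poly_triangular_span P i q
  (fun l lj => let: And3 _ s _ := hP l lj in s) sq.
rewrite {1}qE; apply: eq_bigr => -[a ai] _ /=; congr (_ *: _).
rewrite qE mulr_suml linear_sum (bigD1 (Ordinal ai))//= big1 ?addr0; last first.
  move=> [b bi] ba; rewrite -scalerAl linearZ /=.
  have {}ba : b != a by [].
  have [_ sa oa] := hP a ai; have [_ sb ob] := hP b bi.
  case: (ltngtP b a) ba => // h _; first by rewrite (mulrC (P b)) oa ?mulr0// sb.
  by rewrite ob ?mulr0// sa.
rewrite -scalerAl linearZ /= -expr2 mulfK// gt_eqF//; apply: Lpos; first exact: isOP_neq0 (hP a ai).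
by have [_ -> _] := hP a ai; apply: leq_trans ai ik.
Qed.

End Functional.

Definition node_sum (bs : seq R) (lam : R -> R) q := \sum_(b <- bs) lam b * q.[b].

Lemma node_sum_is_linear bs lam : scalar (node_sum bs lam).
Proof.
move=> a p q; rewrite /node_sum mulr_sumr -big_split /=; apply: eq_bigr => b _.
by rewrite !hornerE /= mulrDr -mulrA mulrCA.
Qed.
HB.instance Definition _ bs lam := GRing.isLinear.Build R {poly R} R _ (node_sum bs lam)
  (@node_sum_is_linear bs lam).

Lemma node_sum_posdef bs lam : uniq bs -> (forall b, b \in bs -> 0 < lam b) ->
  posdef (node_sum bs lam) (size bs).
Proof.
move=> ubs lpos q q0 sq.
have ge0 b : b \in bs -> 0 <= lam b * (q ^+ 2).[b].
  by move=> bbs; rewrite horner_exp mulr_ge0 ?sqr_ge0// ltW// lpos.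
rewrite lt_neqAle; apply/andP; split; last first.
  by rewrite /node_sum big_seq; apply: sumr_ge0.
apply/negP => /eqP e0; have : all (root q) bs.
  apply/allP => b bbs; move/eqP: e0; rewrite eq_sym /node_sum big_seq psumr_eq0// => /allP /(_ b bbs).
  by rewrite bbs /= mulf_eq0 gt_eqF ?lpos//= horner_exp expf_eq0 /= => /eqP ?; apply/eqP.
by move=> rq; have := max_poly_roots q0 rq ubs; rewrite ltnNge sq.
Qed.

Section RightEnd.
Variables (bs : seq R) (x : R) (lam : R -> R).
Hypothesis sorted_bs : sorted <%R (rcons bs x).
Hypothesis lam_gt0 : forall b, b \in rcons bs x -> 0 < lam b.

Let L := node_sum (rcons bs x) lam.
Let L' := node_sum bs (fun b => lam b * (x - b)).

Let LB p q : L (p - q) = L p - L q. Proof. exact: linearB. Qed.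
Let LD p q : L (p + q) = L p + L q. Proof. exact: linearD. Qed.
Let LZ c p : L (c *: p) = c * L p. Proof. exact: linearZ. Qed.

Lemma rcons_lt b : b \in bs -> b < x.
Proof.
by move: sorted_bs; rewrite (sorted_pairwise lt_trans) pairwise_rcons => /andP[/allP h _] /h.
Qed.

Let Lpos : posdef L (size bs).+1.
Proof.
rewrite -(size_rcons bs x); apply: node_sum_posdef lam_gt0.
exact: (sorted_uniq lt_trans (@ltxx _ _) sorted_bs).
Qed.

Let L'pos : posdef L' (size bs).
Proof.
apply: node_sum_posdef.
  have := sorted_uniq lt_trans (@ltxx _ _) sorted_bs.
  by rewrite rcons_uniq => /andP[].
move=> b bbs; rewrite mulr_gt0 ?subr_gt0 ?rcons_lt// lam_gt0//.
by rewrite mem_rcons inE bbs orbT.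
Qed.

Lemma node_sum_rcons_XsubC q : L (('X - x%:P) * q) = - L' q.
Proof.
rewrite /L /L' /node_sum big_rcons /= hornerM hornerXsubC subrr mul0r mulr0 addr0.
rewrite -sumrN; apply: eq_bigr => b _.
by rewrite hornerM hornerXsubC; ring.
Qed.

(** Let u be the previous orthogonal polynomial, and v the one of the same degree
    for the weights multiplied by x - b.  Then ('X - x) v = p + c u with c < 0,
    and evaluation at x gives p(x) = - c u(x). *)
Lemma isOP_right_gt0 l p : (l < (size bs).+1)%N -> isOP L l p -> 0 < p.[x].
Proof.
elim: l p => [|l IH] p ls hp.
  have [mp sp _] := hp; have /eqP/size_poly1P [c c0 pE] := sp.
  by have := monicP mp; rewrite pE lead_coefC hornerC => ->.
have [u hu] : exists u, isOP L l u := isOP_exists Lpos (ltnW (ltnW ls)).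
have [v hv] : exists v, isOP L' l v := isOP_exists L'pos (ltnW ls).
have [mp sp op] := hp; have [mu su ou] := hu; have [mv sv ov] := hv.
have u2 : 0 < L (u ^+ 2) by apply: Lpos; rewrite ?monic_neq0// su ltnW.
(* w - p - c u has degree at most l and is orthogonal to itself. *)
pose w := ('X - x%:P) * v.
pose c := L (w * u) / L (u ^+ 2).
have c0 : c < 0.
  rewrite /c pmulr_llt0 ?invr_gt0// /w -mulrA node_sum_rcons_XsubC oppr_lt0.
  have -> : L' (v * u) = L' (v ^+ 2) by exact: isOP_mul hv mu su.
  by apply: L'pos; [exact: monic_neq0|rewrite sv].
have sw : size w = l.+2 by rewrite size_monicM ?monicXsubC ?monic_neq0// size_XsubC sv.
have mw : w \is monic by rewrite monicMl ?monicXsubC.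
have d0 : w - p - c *: u = 0.
  apply/eqP/negP => /negP d0.
  have sd : (size (w - p - c *: u)%R <= l.+1)%N.
    apply: leq_trans (size_polyD _ _) _; rewrite geq_max size_monicB//= size_polyN.
    by apply: leq_trans (size_scale_leq _ _) _; rewrite su.
  have := Lpos d0 (leq_trans sd (ltnW ls)); rewrite expr2.
  set d := w - p - _; suff -> : L (d * d) = 0 by rewrite ltxx.
  pose r := d - d`_l *: u.
  have sr : (size r <= l)%N.
    apply/leq_sizeP => j; rewrite leq_eqVlt => /predU1P[<-|lj].
      by have := monicP mu; rewrite lead_coefE su /= /r coefB coefZ => ->; rewrite mulr1 subrr.
    by rewrite /r coefB coefZ [u`_j]nth_default ?su// mulr0 subr0 nth_default// (leq_trans sd).
  have -> : L (d * d) = L (d * r) + d`_l * L (d * u).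
    by rewrite -LZ -LD scalerAr -mulrDr subrK.
  have -> : L (d * u) = 0.
    rewrite /d !mulrBl !LB op ?su// subr0 -scalerAl LZ -expr2 divfK ?subrr//.
    by rewrite gt_eqF.
  rewrite mulr0 addr0 /d !mulrBl !LB. 
  have -> : L (c *: u * r) = 0 by rewrite -scalerAl LZ ou// mulr0.
  have -> : L (p * r) = 0 by rewrite op// leqW.
  by rewrite /w -mulrA node_sum_rcons_XsubC ov// oppr0 !addr0.
have := congr1 (horner^~ x) d0.
rewrite /= !(hornerD, hornerN, hornerZ) /w hornerM hornerXsubC subrr mul0r sub0r horner0.
move=> h; have -> : p.[x] = - c * u.[x] by lra.
apply: mulr_gt0; first by rewrite oppr_gt0.
by apply: IH hu; exact: ltnW.
Qed.

Variable C : {poly R} -> Prop.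
Hypotheses (C0 : C 0) (CD : forall p q, C p -> C q -> C (p + q)).
Hypothesis CZ : forall c p, 0 <= c -> C p -> C (c *: p).
Hypothesis COP : forall i p, (i < (size bs).+1)%N -> isOP L i p -> C p.

(** Up to a factor, the orthogonal polynomial of the weights multiplied by x - b is
    Christoffel's kernel, the sum of P_l(x) P_l / L(P_l^2), whose coefficients are
    positive at the right end x of the support. *)
Lemma isOP_christoffel i p : (i <= size bs)%N -> isOP L' i p -> C p.
Proof.
move=> ib hp; have [mp sp op] := hp.
have /choice [P hP] : forall l, exists u, (l <= i)%N -> isOP L l u.
  move=> l; have [li|li] := leqP l i; last by exists 0.
  have [u hu] : exists u, isOP L l u := isOP_exists Lpos (leq_trans li (leqW ib)).
  by exists u.
have LP l : (l <= i)%N -> L (p * P l) = (P l).[x] * L p.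
  move=> li; have [mu su ou] := hP l li.
  have /factor_theorem [q qE] : root (P l - (P l).[x]%:P) x.
    by rewrite /root !hornerE subrr.
  have sq : (size q <= i)%N.
    have [->|q0] := eqVneq q 0; first by rewrite size_poly0.
    have : (size (P l - (P l).[x]%:P)%R <= l.+1)%N.
      apply: leq_trans (size_polyD _ _) _; rewrite geq_max su leqnn size_polyN.
      by apply: leq_trans (size_polyC_leq1 _) _.
    by rewrite qE size_Mmonic ?monicXsubC// size_XsubC addn2 ltnS => /leq_trans; apply.
  have -> : P l = q * ('X - x%:P) + (P l).[x]%:P by rewrite -qE subrK.
  rewrite mulrDr LD mulrA mulrC node_sum_rcons_XsubC op// oppr0 add0r.
  by rewrite [p * _]mulrC mul_polyC LZ !hornerE subrr mulr0 add0r.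
have P2 l : (l <= i)%N -> 0 < L (P l ^+ 2).
  move=> li; have [mu su ou] := hP l li.
  by apply: Lpos; rewrite ?monic_neq0// su ltnS (leq_trans li).
have Px l : (l <= i)%N -> 0 < (P l).[x].
  by move=> li; apply: isOP_right_gt0 (hP l li); rewrite ltnS (leq_trans li).
have Lp0 : 0 < L p.
  have := P2 i (leqnn i).
  have <- : L (P i * p) = L (P i ^+ 2) by exact: isOP_mul (hP i (leqnn i)) mp sp.
  by rewrite mulrC LP// pmulr_rgt0// Px.
have -> : p = \sum_(l < i.+1) (L (p * P l) / L (P l ^+ 2)) *: P l.
  by apply: (isOP_expand Lpos) => //; rewrite ?ltnS ?sp.
elim/big_ind: _ => // -[l li] _; apply: CZ; last by apply: COP (hP l li); rewrite (leq_trans li).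
by apply: divr_ge0; apply: ltW; [rewrite LP// mulr_gt0// Px|exact: P2].
Qed.

End RightEnd.

(** An argument of Cohn and Kumar, by induction from the right.  Dropping the largest
    node x and multiplying the weights by x - b keeps the shorter prefix products,
    and the product over all remaining nodes is orthogonal of top degree for the
    new weights; Christoffel's kernel brings the cone back to the old weights. *)
Lemma cone_prefix_prod bs lam (C : {poly R} -> Prop) : sorted <%R bs ->
  (forall b, b \in bs -> 0 < lam b) ->
  C 0 -> (forall p q, C p -> C q -> C (p + q)) ->
  (forall c p, 0 <= c -> C p -> C (c *: p)) ->
  (forall i p, (i < size bs)%N -> isOP (node_sum bs lam) i p -> C p) ->
  forall k, (k < size bs)%N -> C (\prod_(b <- take k bs) ('X - b%:P)).
Proof.
move=> sbs lpos C0 CD CZ; elim/last_ind: bs lam sbs lpos => [//|bs x IH] lam sbs lpos COP k.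
rewrite size_rcons in COP *; rewrite ltnS => kb.
have CL' i p := @isOP_christoffel bs x lam sbs lpos C C0 CD CZ COP i p.
move: kb; rewrite leq_eqVlt => /predU1P[->|kb].
  rewrite -cats1 take_size_cat//; apply: (CL' (size bs)) => //; split.
  - by rewrite monic_prod_XsubC.
  - by rewrite size_prod_XsubC.
  - move=> q _; rewrite /node_sum big_seq big1// => b bbs.
    by rewrite hornerM (_ : _.[b] = 0) ?mul0r ?mulr0//; apply/rootP; rewrite root_prod_XsubC.
rewrite -cats1 takel_cat; last exact: ltnW.
apply: (IH (fun b => lam b * (x - b))) => //.
- by move: sbs; rewrite -cats1 => /cat_sorted2[].
- move=> b bbs; rewrite mulr_gt0 ?subr_gt0 ?(rcons_lt sbs)// lpos//.
  by rewrite mem_rcons inE bbs orbT.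
- by move=> i p ib; apply: CL'; exact: ltnW.
Qed.

End OrthogonalPolynomials.

(** * Hermite interpolation in Newton form *)

Section Interpolation.
Variable R : realType.
Implicit Types (g : R -> R) (s : seq R).

(** The zeros found lie strictly between consecutive given ones; being different
    from the given points, they can be joined by zeros of the derivative that are
    known at these points. *)
Lemma rolle_path g g' (a : R) s : path <%R a s ->
  {within `[a, last a s], continuous g} ->
  (forall t : R, t \in `]a, last a s[ -> is_derive t 1 g (g' t)) ->
  (forall z : R, z \in a :: s -> g z = 0) ->
  exists s', [/\ size s' = size s, uniq s' &
    forall z : R, z \in s' -> [/\ z \in `]a, last a s[, g' z = 0 & z \notin a :: s]].
Proof.
elim: s a => [|b s IH] a /=; first by move=> *; exists [::]; split.
move=> /andP[ab pb] cg dg g0.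
have blast : b <= last b s.
  have := pb; rewrite lt_path_sortedE => /andP[/allP h _].
  case: s h {IH pb cg dg g0} => [|c s] h //=.
  by apply/ltW/h; rewrite mem_last.
have c1 : {within `[b, last b s], continuous g}.
  by refine (continuous_subspaceW _ cg); apply: subset_itvr; rewrite bnd_simp; exact: ltW.
have d1 (t : R) : t \in `]b, last b s[ -> is_derive t 1 g (g' t).
  rewrite in_itv/= => /andP[bt tl]; apply: dg.
  by rewrite in_itv/= (lt_trans ab bt).
have z1 (z : R) : z \in b :: s -> g z = 0.
  by move=> zs; apply: g0; rewrite inE zs orbT.
have [s' [ss us hs]] := IH b pb c1 d1 z1.
have dab (t : R) : t \in `]a, b[ -> is_derive t 1 g (g' t).
  rewrite in_itv/= => /andP[at' tb]; apply: dg.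
  by rewrite in_itv/= at' (lt_le_trans tb).
have [x xab dx] : exists2 x : R, x \in `]a, b[ & is_derive x 1 g 0.
  apply: Rolle => //.
  - by move=> t /dab [].
  - by refine (continuous_subspaceW _ cg); apply: subset_itvl; rewrite bnd_simp.
  - by rewrite !g0 ?inE ?eqxx ?orbT.
have gx : g' x = 0.
  by have [_ <-] := dab x xab; have [_ ->] := dx.
move: (xab); rewrite in_itv/= => /andP[ax xb].
exists (x :: s'); split; first by rewrite /= ss.
  rewrite /= us andbT; apply/negP => /hs [+ _ _].
  by rewrite in_itv/= => /andP[bx _]; rewrite ltNge (ltW xb) in bx.
move=> z; rewrite inE => /predU1P[->|zs].
  split=> //; first by rewrite in_itv/= ax (lt_le_trans xb).
  rewrite !inE !negb_or gt_eqF//= lt_eqF//=; apply/negP => xs.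
  have := pb; rewrite lt_path_sortedE => /andP[/allP /(_ x xs) bx _].
  by rewrite ltNge (ltW xb) in bx.
have [zb gz zn] := hs z zs; move: (zb); rewrite in_itv/= => /andP[bz zl].
have az := lt_trans ab bz.
split=> //; first by rewrite in_itv/= az.
by rewrite inE negb_or gt_eqF.
Qed.

Lemma sorted_path_cons s : (0 < size s)%N -> sorted <%R s ->
  exists a s', s = a :: s' /\ path <%R a s'.
Proof. by case: s => // a s _ h; exists a, s. Qed.

Lemma rolle_iter (G : nat -> R -> R) (K j r : nat) s :
  (forall i (t : R), (i < K)%N -> (t \in `]0, 1[) -> is_derive t 1 (G i) (G i.+1 t)) ->
  uniq s -> size s = r.+1 -> (j + r <= K)%N ->
  (forall z : R, z \in s -> (z \in `]0, 1[) /\ G j z = 0) ->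
  exists2 x : R, x \in `]0, 1[ & G (j + r)%N x = 0.
Proof.
move=> dG; elim: r j s => [|r IH] j s us ss jK hs.
  case: s us ss hs => [//|x s _ _ hs]; have [x1 x2] := hs x (mem_head _ _).
  by exists x => //; rewrite addn0.
have [a [s1 [sE ps]]] : exists a s1, sort <=%R s = a :: s1 /\ path <%R a s1.
  apply: sorted_path_cons; first by rewrite size_sort ss.
  by rewrite lt_sorted_uniq_le sort_uniq us sort_le_sorted.
have ms z : (z \in a :: s1) = (z \in s) by rewrite -sE mem_sort.
have sub (t : R) : t \in `[a, last a s1] -> t \in `]0, 1[.
  rewrite !in_itv/= => /andP[at' tl].
  have [+ _] := hs a (eq_ind _ is_true (mem_head a s1) _ (ms a)).
  have [+ _] := hs (last a s1) (eq_ind _ is_true (mem_last a s1) _ (ms _)).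
  rewrite !in_itv/= => /andP[_ l1] /andP[a0 _].
  by rewrite (lt_le_trans a0 at') (le_lt_trans tl l1).
have jK' : (j < K)%N by apply: leq_trans jK; rewrite addnS ltnS leq_addr.
have c1 : {within `[a, last a s1], continuous G j}.
  by apply: derivable_within_continuous => t /sub t01; have [] := dG j t jK' t01.
have d1 (t : R) : t \in `]a, last a s1[ -> is_derive t 1 (G j) (G j.+1 t).
  by move=> ht; exact: (dG j t jK' (sub t (subset_itv_oo_cc ht))).
have z1 (z : R) : z \in a :: s1 -> G j z = 0 by rewrite ms => /hs [].
have [s' [ss' us' hs']] := rolle_path ps c1 d1 z1.
have [||||x x01 Gx] := IH j.+1 s' => //.
- by rewrite ss'; have := congr1 size sE; rewrite size_sort ss /= => -[].
- by rewrite addSnnS.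
- by move=> z /hs' [zi gz _]; split=> //; apply: sub; exact: subset_itv_oo_cc.
- by exists x => //; rewrite -addSnnS.
Qed.

Variables (m : nat) (f : R -> R).
Hypothesis f_cont : {within `[0, 1], continuous f}.
Hypothesis f_deriv : forall k : nat, (1 <= k <= m)%N -> forall t : R, (t \in `]0, 1[) ->
  derivable (derive1n k.-1 f) t 1.

Lemma is_derive_ladder (q : {poly R}) j (t : R) : (j < m)%N -> (t \in `]0, 1[) ->
  is_derive t 1 (fun u => derive1n j f u - (derivn j q).[u])
    (derive1n j.+1 f t - (derivn j.+1 q).[t]).
Proof.
move=> jm t01; have d1 : is_derive t 1 (derive1n j f) (derive1n j.+1 f t).
  rewrite derive1nS derive1E; apply: derivableP; exact: (f_deriv (k := j.+1)).
have d2 := is_derive_poly (derivn j q) t.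
rewrite derivnS; exact: is_deriveB.
Qed.

(** The derivative of f - q vanishes between consecutive points of Z and at the
    points of D, which makes k zeros in ]0, 1[; k - 1 applications of Rolle's
    theorem remain. *)
Lemma hermite_rolle (q : {poly R}) (k : nat) (Z D : seq R) :
  (0 < k <= m)%N -> sorted <%R Z -> uniq D -> {subset D <= Z} ->
  (size Z + size D = k.+1)%N -> (0 < size Z)%N ->
  (forall z : R, z \in Z -> (z \in `[0, 1]) /\ f z = q.[z]) ->
  (forall z : R, z \in D -> (z \in `]0, 1[) /\ derive1n 1 f z = (derivn 1 q).[z]) ->
  exists2 x : R, x \in `]0, 1[ & derive1n k f x = (derivn k q).[x].
Proof.
move=> /andP[k0 km] sZ uD DZ sk Z0 hZ hD.
have [a [s [ZE ps]]] := sorted_path_cons Z0 sZ.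
pose G j u := derive1n j f u - (derivn j q).[u].
have aZ : a \in Z by rewrite ZE mem_head.
have lZ : last a s \in Z by rewrite ZE mem_last.
have [a01 _] := hZ a aZ; have [l01 _] := hZ _ lZ.
move: a01 l01; rewrite !in_itv/= => /andP[a0 a1] /andP[l0 l1].
have c1 : {within `[a, last a s], continuous G 0%N}.
  have cf : {within `[a, last a s], continuous f}.
    refine (continuous_subspaceW _ f_cont) => t /=; rewrite !in_itv/= => /andP[at' tl].
    by rewrite (le_trans a0 at') (le_trans tl l1).
  have cq : {within `[a, last a s], continuous (horner (derivn 0 q))}.
    by apply: continuous_subspaceT => x; exact: continuous_horner.
  by move=> t; apply: cvgB; [exact: cf|exact: cq].
have d1 (t : R) : t \in `]a, last a s[ -> is_derive t 1 (G 0%N) (G 1%N t).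
  rewrite in_itv/= => /andP[at' tl]; apply: is_derive_ladder.
    exact: leq_trans k0 km.
  by rewrite in_itv/= (le_lt_trans a0 at') (lt_le_trans tl l1).
have z1 (z : R) : z \in a :: s -> G 0%N z = 0.
  rewrite -ZE => /hZ [_ fz]; rewrite /G derivn0 -fz.
  by rewrite /derive1n /= subrr.
have [s' [ss us hs]] := rolle_path ps c1 d1 z1.
have [||||x x01 Gx] := @rolle_iter G m 1 k.-1 (s' ++ D) (is_derive_ladder q).
- rewrite cat_uniq us uD andbT /=; apply/hasPn => z zD.
  by apply/negP => /hs [_ _]; rewrite -ZE DZ.
- by rewrite size_cat ss prednK//; move: sk; rewrite ZE /= addSn => -[].
- by rewrite add1n prednK.
- move=> z; rewrite mem_cat => /orP[/hs [zi gz _]|/hD [zi gz]]; split=> //.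
    move: zi; rewrite !in_itv/= => /andP[az zl].
    by rewrite (le_lt_trans a0 az) (lt_le_trans zl l1).
  by rewrite /G gz subrr.
exists x => //; move: Gx; rewrite /G add1n prednK// => /eqP.
by rewrite subr_eq0 => /eqP.
Qed.

Lemma derivn_top (q : {poly R}) k x : (size q <= k.+1)%N ->
  (derivn k q).[x] = (k`!)%:R * q`_k.
Proof.
move=> sq; have -> : derivn k q = ((k`!)%:R * q`_k)%:P.
  apply/polyP => i; rewrite coef_derivn coefC; case: i => [|i] /=.
    by rewrite addn0 ffactnn mulr_natl.
  by rewrite nth_default ?mul0rn// (leq_trans sq)// addnS ltnS leq_addr.
by rewrite hornerC.
Qed.

Definition nodal (T : seq R) k : {poly R} := \prod_(t <- take k T) ('X - t%:P).

Lemma size_nodal T k : (k <= size T)%N -> size (nodal T k) = k.+1.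
Proof. by move=> kT; rewrite size_prod_XsubC size_takel. Qed.

Lemma nodal_monic T k : nodal T k \is monic.
Proof. exact: monic_prod_XsubC. Qed.

Lemma root_nodal T k x : root (nodal T k) x = (x \in take k T).
Proof. exact: root_prod_XsubC. Qed.

Lemma deriv_double_root (P Q : {poly R}) x : root P x -> root Q x -> (deriv (P * Q)).[x] = 0.
Proof. by move=> /rootP p0 /rootP q0; rewrite derivM !hornerE p0 q0 mulr0 mul0r addr0. Qed.

Lemma deriv_simple_root (P : {poly R}) x : (deriv (('X - x%:P) * P)).[x] = P.[x].
Proof. by rewrite derivM derivXsubC mul1r hornerD hornerM hornerXsubC subrr mul0r addr0. Qed.

Variables (Z D : seq R).
Hypotheses (sZ : sorted <%R Z) (uD : uniq D) (DZ : {subset D <= Z}).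
Hypotheses (Z01 : forall z : R, z \in Z -> z \in `[0, 1]).
Hypotheses (D01 : forall z : R, z \in D -> z \in `]0, 1[).
Hypotheses (Z0 : (0 < size Z)%N) (ZDm : (size Z + size D = m)%N).

Let N := nodal (Z ++ D).
Let uZ : uniq Z := sorted_uniq lt_trans (@ltxx _ _) sZ.

Definition interpolates k (h : {poly R}) :=
  (forall z, z \in take k Z -> f z = h.[z]) /\
  (forall z, z \in take (k - size Z) D -> derive1n 1 f z = (derivn 1 h).[z]).

(** The next Newton coefficient is fixed by the value at a new node, or by the
    derivative at a node met for the second time, which is a simple root of the
    current nodal polynomial. *)
Lemma interpolates_step k h : (k < m)%N -> interpolates k h ->
  exists e, interpolates k.+1 (h + e *: N k).
Proof.
move=> km [hZ hD]; have [kZ|Zk] := ltnP k (size Z).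
  set z := nth 0 Z k.
  have Nz : (N k).[z] != 0.
    rewrite -/(root _ _) root_nodal takel_cat ?(ltnW kZ)//; apply/negP => zk.
    have := uZ; rewrite -(cat_take_drop k Z) (drop_nth 0 kZ) cat_uniq => /and3P[_ /hasPn + _].
    by move=> /(_ z (mem_head _ _)) /negP.
  exists ((f z - h.[z]) / (N k).[z]); split; last first.
    by rewrite (eqP (_ : k.+1 - size Z == 0)%N) ?take0// subn_eq0.
  move=> x; rewrite (take_nth 0 kZ) mem_rcons inE => /predU1P[->|xk].
    by rewrite hornerD hornerZ -/z divfK// addrC subrK.
  rewrite hornerD hornerZ (hZ x xk) (_ : (N k).[x] = 0) ?mulr0 ?addr0//.
  by apply/rootP; rewrite root_nodal takel_cat// ltnW.
set i := (k - size Z)%N; have iD : (i < size D)%N by move: km; rewrite -ZDm /i; lia.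
have kE : k = (size Z + i)%N by rewrite /i subnKC.
have NE : N k = (\prod_(t <- Z) ('X - t%:P)) * (\prod_(t <- take i D) ('X - t%:P)).
  by rewrite /N /nodal kE take_cat ltnNge leq_addr /= addKn big_cat.
set d := nth 0 D i.
have dD : d \in D by rewrite mem_nth.
have Nd : (deriv (N k)).[d] != 0.
  rewrite NE (perm_big _ (perm_to_rem (DZ dD))) big_cons /= -mulrA deriv_simple_root.
  rewrite hornerM; apply: mulf_neq0; rewrite -/(root _ _) root_prod_XsubC.
    by rewrite mem_rem_uniq// inE eqxx.
  apply/negP => di.
  have := uD; rewrite -(cat_take_drop i D) (drop_nth 0 iD) cat_uniq => /and3P[_ /hasPn + _].
  by move=> /(_ d (mem_head _ _)) /negP.
exists ((derive1n 1 f d - (derivn 1 h).[d]) / (deriv (N k)).[d]); split.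
  rewrite take_oversize ?leqW// => x xZ.
  rewrite hornerD hornerZ (_ : (N k).[x] = 0) ?mulr0 ?addr0; last first.
    by apply/rootP; rewrite NE rootM root_prod_XsubC xZ.
  by apply: hZ; rewrite take_oversize.
rewrite subSn// -/i (take_nth 0 iD) -/d => x; rewrite mem_rcons inE.
rewrite !derivn1 derivD derivZ hornerD hornerZ => /predU1P[->|xi].
  by rewrite divfK// addrC subrK.
have -> : (deriv (N k)).[x] = 0.
  rewrite NE; apply: deriv_double_root; rewrite root_prod_XsubC//.
  by apply: DZ; exact: mem_take xi.
by rewrite mulr0 addr0 (hD x xi) derivn1.
Qed.

Definition newton (c : nat -> R) k := \sum_(j < k) c j *: N j.

Lemma size_newton c k : (k <= m)%N -> (size (newton c k) <= k)%N.
Proof.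
move=> km; apply: leq_trans (size_sum _ _ _) _; apply/bigmax_leqP => j _.
apply: leq_trans (size_scale_leq _ _) _.
by rewrite size_nodal// size_cat ZDm (leq_trans _ km)// ltnW.
Qed.

(** The coefficient of index j is the leading coefficient of an interpolant of degree
    j at j + 1 nodes, so Rolle's theorem makes it a derivative divided by j!. *)
Lemma newton_exists : exists c, interpolates m (newton c m) /\
  forall j, (0 < j < m)%N -> exists2 x : R, x \in `]0, 1[ & derive1n j f x = (j`!)%:R * c j.
Proof.
suff : forall k, (k <= m)%N -> exists c, interpolates k (newton c k) /\
    forall j, (0 < j < k)%N -> exists2 x : R, x \in `]0, 1[ & derive1n j f x = (j`!)%:R * c j.
  exact.
elim=> [_|k IH km].
  exists (fun=> 0); split; first by split=> z; rewrite ?sub0n take0.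
  by move=> j; rewrite ltn0 andbF.
have [c [hc cx]] := IH (ltnW km).
have [e he] := interpolates_step km hc.
pose c' j := if j == k then e else c j.
have newtonE : newton c' k.+1 = newton c k + e *: N k.
  rewrite /newton big_ord_recr /= {2}/c' eqxx; congr (_ + _).
  by apply: eq_bigr => j _; rewrite /c' ltn_eqF.
exists c'; rewrite newtonE; split=> // j /andP[j0]; rewrite ltnS leq_eqVlt => /predU1P[jk|jk].
  rewrite jk /c' eqxx; have k0 : (0 < k)%N by rewrite -jk.
  have [hZ hD] := he; set q := newton c k + e *: N k in hZ hD.
  have kT : (k <= size (Z ++ D))%N by rewrite size_cat ZDm ltnW.
  have sq : (size q <= k.+1)%N.
    apply: leq_trans (size_polyD _ _) _; rewrite geq_max (leq_trans (size_newton c (ltnW km)))//=.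
    by apply: leq_trans (size_scale_leq _ _) _; rewrite size_nodal.
  have qk : q`_k = e.
    rewrite /q coefD coefZ nth_default ?size_newton ?(ltnW km)// add0r.
    by have := monicP (nodal_monic (Z ++ D) k); rewrite lead_coefE size_nodal//= => ->; rewrite mulr1.
  have := @hermite_rolle q k (take k.+1 Z) (take (k.+1 - size Z) D).
  case.
  - by rewrite k0 ltnW.
  - exact: take_sorted.
  - exact: take_uniq.
  - have [kZ|Zk] := leqP k.+1 (size Z).
      by rewrite (eqP (_ : k.+1 - size Z == 0)%N) ?take0// subn_eq0.
    by rewrite [take k.+1 Z]take_oversize ?(ltnW Zk)// => x /mem_take /DZ.
  - by rewrite !size_take_min; move: km; rewrite -ZDm; lia.
  - by rewrite size_take_min; move: Z0; lia.
  - by move=> z zk; split; [apply/Z01/(mem_take zk)|exact: hZ].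
  - by move=> z zk; split; [apply/D01/(mem_take zk)|exact: hD].
  by move=> x x01 xE; exists x => //; rewrite xE derivn_top// qk.
rewrite /c' ltn_eqF//; apply: cx; by rewrite j0.
Qed.

(** The quotient of the error by the nodal polynomial is the Newton coefficient
    obtained by adding s to the nodes. *)
Lemma newton_error (h : {poly R}) (s : R) : interpolates m h -> (size h <= m)%N ->
  s \in `[0, 1] -> s \notin Z -> (0 < m)%N ->
  exists2 x : R, x \in `]0, 1[ &
    f s - h.[s] = derive1n m f x / (m`!)%:R * (N m).[s].
Proof.
move=> [hZ hD] sh s01 sNZ m0.
have sT : size (Z ++ D) = m by rewrite size_cat.
have NE : N m = \prod_(t <- Z ++ D) ('X - t%:P) by rewrite /N /nodal take_oversize ?sT.
have Ns : (N m).[s] != 0.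
  rewrite NE -/(root _ _) root_prod_XsubC mem_cat negb_or sNZ /=.
  by apply: contra sNZ => /DZ.
pose e := (f s - h.[s]) / (N m).[s]; pose q := h + e *: N m.
have sq : (size q <= m.+1)%N.
  apply: leq_trans (size_polyD _ _) _; rewrite geq_max leqW//=.
  by apply: leq_trans (size_scale_leq _ _) _; rewrite size_nodal ?sT.
have qm : q`_m = e.
  rewrite /q coefD coefZ nth_default// add0r.
  have := monicP (nodal_monic (Z ++ D) m); rewrite lead_coefE size_nodal ?sT//= => ->.
  by rewrite mulr1.
have mZ z : (z \in sort <=%R (s :: Z)) = (z == s) || (z \in Z) by rewrite mem_sort inE.
have [] := @hermite_rolle q m (sort <=%R (s :: Z)) D.
- by rewrite m0 leqnn.
- by rewrite lt_sorted_uniq_le sort_uniq /= sNZ uZ sort_le_sorted.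
- exact: uD.
- by move=> z /DZ zZ; rewrite mZ zZ orbT.
- by rewrite size_sort /= addSn ZDm.
- by rewrite size_sort.
- move=> z; rewrite mZ => /predU1P[->|zZ]; split=> //.
  + by rewrite /q hornerD hornerZ divfK// addrC subrK.
  + exact: Z01.
  + rewrite /q hornerD hornerZ (_ : (N m).[z] = 0) ?mulr0 ?addr0.
      by apply: hZ; rewrite take_oversize// -ZDm leq_addr.
    by apply/rootP; rewrite NE root_prod_XsubC mem_cat zZ.
- move=> z zD; split; first exact: D01.
  rewrite /q !derivn1 derivD derivZ hornerD hornerZ NE big_cat deriv_double_root.
  + by rewrite mulr0 addr0 -derivn1; apply: hD; rewrite take_oversize// -ZDm addKn.
  + by rewrite root_prod_XsubC DZ.
  + by rewrite root_prod_XsubC.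
move=> x x01 xE; exists x => //.
by rewrite xE derivn_top// qm [_ * e]mulrC mulfK ?pnatr_eq0 -?lt0n ?fact_gt0// divfK.
Qed.

End Interpolation.

(** * Integrals of bounded measurable functions *)

Section BoundedMeasurable.
Context d (T : measurableType d) (R : realType).
Implicit Types (h : T -> R).

Definition bdd_meas h := measurable_fun setT h /\ exists M : R, forall x, `|h x| <= M.

Lemma bdd_meas_cst (c : R) : bdd_meas (fun=> c).
Proof. by split; [exact: measurable_cst|exists `|c|]. Qed.

Lemma bdd_measD h1 h2 : bdd_meas h1 -> bdd_meas h2 -> bdd_meas (fun x => h1 x + h2 x).
Proof.
move=> [m1 [M1 b1]] [m2 [M2 b2]]; split; first exact: measurable_funD.
by exists (M1 + M2) => x; apply: le_trans (ler_normD _ _) _; apply: lerD.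
Qed.

Lemma bdd_measM h1 h2 : bdd_meas h1 -> bdd_meas h2 -> bdd_meas (fun x => h1 x * h2 x).
Proof.
move=> [m1 [M1 b1]] [m2 [M2 b2]]; split; first exact: measurable_funM.
by exists (M1 * M2) => x; rewrite normrM; apply: ler_pM.
Qed.

Lemma bdd_measZ c h : bdd_meas h -> bdd_meas (fun x => c * h x).
Proof. by apply: bdd_measM; exact: bdd_meas_cst. Qed.

Lemma bdd_measB h1 h2 : bdd_meas h1 -> bdd_meas h2 -> bdd_meas (fun x => h1 x - h2 x).
Proof.
move=> b1 b2; rewrite (_ : (fun x => _) = (fun x => h1 x + -1 * h2 x)).
  by apply: bdd_measD => //; exact: bdd_measZ.
by apply/funext => x; rewrite mulN1r.
Qed.

Lemma bdd_meas_sum (I : Type) (r : seq I) (P : pred I) (F : I -> T -> R) :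
  (forall i, bdd_meas (F i)) -> bdd_meas (fun x => \sum_(i <- r | P i) F i x).
Proof.
move=> bF; elim: r => [|i r IH].
  rewrite (_ : (fun x => _) = (fun=> 0)); first exact: bdd_meas_cst.
  by apply/funext => x; rewrite big_nil.
rewrite (_ : (fun x => _) = if P i then (fun x => F i x + \sum_(j <- r | P j) F j x)
  else (fun x => \sum_(j <- r | P j) F j x)).
  by case: ifP => // _; exact: bdd_measD.
by apply/funext => x; rewrite big_cons; case: ifP.
Qed.

Lemma bdd_meas_indic (A : set T) : measurable A -> bdd_meas (\1_A : T -> R).
Proof.
move=> mA; split; first exact: measurable_indic.
by exists 1 => x; rewrite indicE; case: (_ \in _); rewrite ?normr1 ?normr0 ?ler01.
Qed.

Variables (m : {measure set T -> \bar R}) (m1 : m setT = 1%E).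

Lemma bdd_meas_integrable h : bdd_meas h -> m.-integrable setT (EFin \o h).
Proof.
move=> [mh [M bh]]; apply: measurable_bounded_integrable => //.
  by rewrite m1 ltry.
exists M; split; first exact: num_real.
by move=> x Mx y _; apply: le_trans (bh y) (ltW Mx).
Qed.

Lemma expect_cst (c : R) : \int[m]_x c = c.
Proof. by rewrite Rintegral_cst// m1 mulr1. Qed.

Lemma expectD h1 h2 : bdd_meas h1 -> bdd_meas h2 ->
  \int[m]_x (h1 x + h2 x) = \int[m]_x h1 x + \int[m]_x h2 x.
Proof. by move=> b1 b2; apply: RintegralD => //; exact: bdd_meas_integrable. Qed.

Lemma expectZ c h : bdd_meas h -> \int[m]_x (c * h x) = c * \int[m]_x h x.
Proof. by move=> b1; apply: RintegralZl => //; exact: bdd_meas_integrable. Qed.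

Lemma expect_sum (I : Type) (r : seq I) (F : I -> T -> R) :
  (forall i, bdd_meas (F i)) ->
  \int[m]_x (\sum_(i <- r) F i x) = \sum_(i <- r) \int[m]_x F i x.
Proof.
move=> bF; elim: r => [|i r IH].
  by under eq_Rintegral do rewrite big_nil; rewrite expect_cst big_nil.
under eq_Rintegral do rewrite big_cons.
by rewrite expectD ?IH ?big_cons//; exact: bdd_meas_sum.
Qed.

Lemma expect_eq0 h : bdd_meas h -> (forall x, 0 <= h x) ->
  \int[m]_x h x = 0 <-> m [set x | h x != 0] = 0%E.
Proof.
move=> bh h0; have [mh _] := bh.
have mhE : measurable_fun setT (EFin \o h) by exact/measurable_EFinP.
have -> : (\int[m]_x h x = 0) <-> (\int[m]_(x in setT) `|(EFin \o h) x| = 0)%E.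
  have e : (\int[m]_(x in setT) `|(EFin \o h) x| = \int[m]_(x in setT) (h x)%:E)%E.
    by apply: eq_integral => x _; rewrite /= ger0_norm.
  rewrite e /Rintegral; split=> [i0|-> //].
  rewrite -[LHS]fineK ?i0//; apply: integrable_fin_num => //.
  exact: bdd_meas_integrable bh.
rewrite (ae_eq_integral_abs m measurableT mhE).
have mS : measurable [set x | h x != 0].
  rewrite (_ : [set x | _] = setT `&` h @^-1` (~` [set 0])).
    by apply: mh => //; apply: measurableC; exact: measurable_set1.
  by apply/seteqP; split=> x /=; [move/eqP; split|case=> _ /eqP].
have sE : [set x | h x != 0] = ~` [set x | setT x -> (EFin \o h) x = cst 0%E x].
  apply/seteqP; split=> x /=.
    by move=> /eqP hx /(_ I) [].
  by move=> hn; apply/eqP => hx; apply: hn => _; rewrite hx.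
split.
  move=> [A [mA A0 sA]]; apply/eqP; rewrite -measure_le0 -A0.
  by apply: le_measure; rewrite ?inE// sE; exact: sA.
by move=> S0; exists [set x | h x != 0]; split=> //; rewrite sE.
Qed.

End BoundedMeasurable.

Section Product.
Context d1 d2 (T1 : measurableType d1) (T2 : measurableType d2) (R : realType).
Variables (mu : probability T1 R) (nu : probability T2 R).

Lemma product_setT : (mu \x nu)%E setT = 1%E.
Proof.
rewrite -setXTT product_measure1E//.
by transitivity (1 * 1 : \bar R)%E; [congr (_ * _)%E; exact: probability_setT|rewrite mule1].
Qed.

Lemma iterated_integral (G : T1 * T2 -> R) : bdd_meas G ->
  \int[mu]_x \int[nu]_y G (x, y) = \int[(mu \x nu)%E]_z G z.
Proof.
move=> bG; have iG := bdd_meas_integrable product_setT bG.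
rewrite /Rintegral -(integral12_prod_meas1 iG) /=; congr fine.
apply: eq_integral => x _.
have bGx : bdd_meas (fun y => G (x, y)).
  have [mG [M bM]] := bG; split; last by exists M => y.
  exact: measurableT_comp mG (pair1_measurable x).
rewrite fineK//; apply: integrable_fin_num => //.
by apply: bdd_meas_integrable bGx; exact: probability_setT.
Qed.

End Product.

(** * Integrals over a code and over the sphere *)

Section KappaIntegral.
Context d (T : measurableType d) (R : realType) (N : nat).
Variable C : weighted_code R T N.

Let atom (k : nat) : {measure set T -> \bar R} :=
  if insub k is Some i then
    mscale (NngNum (ltW (code_wt_gt0 C i))) (dirac (code_pt C i))
  else mzero.

Let kappa_ge0_integral (h : T -> R) : measurable_fun setT h -> (forall x, 0 <= h x) ->
  (\int[kappa C]_x (h x)%:E = (\sum_(i < N) code_wt C i * h (code_pt C i))%:E)%E.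
Proof.
move=> mh h0; transitivity (\int[msum atom N]_x (h x)%:E)%E.
  apply: eq_measure_integral => A _ _; rewrite /kappa /msum /=.
  by apply: eq_bigr => i _; rewrite /atom valK.
rewrite ge0_integral_measure_sum//; last 2 first.
- by move=> x _; rewrite lee_fin.
- exact/measurable_EFinP.
rewrite -sumEFin; apply: eq_bigr => i _; rewrite /atom valK.
have mhE : measurable_fun setT (EFin \o h) by exact/measurable_EFinP.
rewrite ge0_integral_mscale//; last by move=> x _; rewrite lee_fin.
by rewrite integral_dirac//= diracT mul1e EFinM.
Qed.

(** Additivity in the measure gives the formula for nonnegative functions; a bounded
    function becomes nonnegative after adding a constant. *)
Lemma kappa_integral (h : T -> R) : bdd_meas h ->
  \int[kappa C]_x h x = \sum_(i < N) code_wt C i * h (code_pt C i).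
Proof.
move=> bh; have [mh [M bM]] := bh.
have hM x : 0 <= h x + M by rewrite -lerBlDr sub0r; have := bM x; rewrite ler_norml => /andP[].
have k1 : kappa C setT = 1%E by exact: probability_setT.
have e := expectD k1 bh (@bdd_meas_cst _ T R M).
rewrite expect_cst// in e.
have : \int[kappa C]_x (h x + M) = \sum_(i < N) code_wt C i * (h (code_pt C i) + M).
  rewrite /Rintegral kappa_ge0_integral//; exact: measurable_funD.
rewrite e; under eq_bigr do rewrite mulrDr.
by rewrite big_split /= -mulr_suml code_wt_sum mul1r => /addIr.
Qed.
End KappaIntegral.

Section SphereMeasure.
Variables (R : realType) (n : nat) (hn : (2 <= n)%N).
Notation S := (sphere R hn).

Lemma continuous_sphere_measurable (h : S -> R) : continuous h -> measurable_fun setT h.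
Proof.
move=> /continuousP ch; apply: (measurability _ (RGenOpens.measurableE R)).
move=> _ [_ [a [b ->] <-]]; rewrite setTI.
by apply: sub_sigma_algebra; apply: ch; exact: interval_open.
Qed.

Lemma measurable_sphere_comp (phi : 'rV[R]_n -> R) : continuous phi ->
  measurable_fun setT (fun x : S => phi (\val x)).
Proof.
move=> cphi; apply: continuous_sphere_measurable => x.
apply: (@continuous_comp _ _ _ (fun x : S => \val x) phi); last exact: cphi.
exact: (@initial_continuous _ _ (@set_val _ (unit_sphere R n))).
Qed.

Lemma sphereP (x : S) : dot (\val x) (\val x) = 1.
Proof. by case: x => x /=; rewrite inE. Qed.

Lemma sdotxx (x : S) : sdot x x = 1. Proof. exact: sphereP. Qed.

Lemma sdot_bound (x y : S) : -1 <= sdot x y <= 1.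
Proof.
(* |x + c y|^2 >= 0 for c = 1 and c = -1 *)
have h (c : R) : 0 <= 1 + c ^+ 2 + 2 * c * sdot x y.
  have -> : 1 + c ^+ 2 + 2 * c * sdot x y =
      \sum_(i < n) ((\val x) 0 i + c * (\val y) 0 i) ^+ 2.
    transitivity (dot (\val x) (\val x) + c ^+ 2 * dot (\val y) (\val y) + 2 * c * sdot x y).
      by rewrite !sphereP mulr1.
    rewrite /sdot /dot !mulr_sumr -!big_split /=.
    by apply: eq_bigr => i _; ring.
  by apply: sumr_ge0 => i _; exact: sqr_ge0.
have := h 1; have := h (-1) => h1 h2; apply/andP; split; lra.
Qed.

Lemma sdot_sqr_bound (x y : S) : sdot x y ^+ 2 \in `[0, 1].
Proof. by rewrite in_itv/= sqr_ge0 /=; have := sdot_bound x y; nra. Qed.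

Lemma measurable_sdot : measurable_fun setT (fun z : S * S => sdot z.1 z.2).
Proof.
rewrite (_ : (fun z : S * S => _) = fun z : S * S => \sum_(i < n) (\val z.1) 0 i * (\val z.2) 0 i) //.
apply: measurable_sum => i.
have mi : measurable_fun setT (fun x : S => (\val x) 0 i).
  by apply: (@measurable_sphere_comp (fun u : 'rV[R]_n => u 0 i)); exact: coord_continuous.
apply: measurable_funM.
- exact: measurableT_comp mi measurable_fst.
- exact: measurableT_comp mi measurable_snd.
Qed.

Lemma bdd_meas_dot (F : R -> R) : measurable_fun `[0, (1 : R)] F ->
  (exists M : R, forall t : R, t \in `[0, 1] -> `|F t| <= M) ->
  bdd_meas (fun z : S * S => F (sdot z.1 z.2 ^+ 2)).
Proof.
move=> mF [M bM]; split; last by exists M => z; exact/bM/sdot_sqr_bound.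
rewrite (_ : (fun z : S * S => _) = (F \_ `[0, 1]) \o (fun z : S * S => sdot z.1 z.2 ^+ 2)).
  apply: measurableT_comp; last by apply: measurable_funX; exact: measurable_sdot.
  by apply/(measurable_restrictT F) => //; exact: measurable_itv.
apply/funext => z /=; rewrite patchE mem_set//; exact: sdot_sqr_bound.
Qed.

Lemma bdd_meas_poly_dot (q : {poly R}) : bdd_meas (fun z : S * S => q.[sdot z.1 z.2 ^+ 2]).
Proof.
have cq : {within `[0, 1], continuous (fun t => q.[t])}.
  by apply: continuous_subspaceT => x; exact: continuous_horner.
apply: bdd_meas_dot.
  by apply: subspace_continuous_measurable_fun => //; exact: measurable_itv.
have [||c _ hc] := @EVT_max R (fun t : R => `|q.[t]|) 0 1.
- exact: ler01.
- by move=> x; apply: cvg_norm; exact: cq.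
by exists `|q.[c]|.
Qed.

(** On the sphere the square of each feature is at most the diagonal value q(1), so
    features are bounded. *)
Lemma psd_features (q : {poly R}) : psd_kernel n q -> exists (J : finType) (g : J -> S -> R),
  (forall j, bdd_meas (g j)) /\ forall x y, q.[sdot x y] = \sum_j g j x * g j y.
Proof.
move=> [J [phi [cphi phiE]]]; exists J, (fun j x => phi j (\val x)); split.
  move=> j; split; first exact: measurable_sphere_comp.
  exists (q.[1] + 1) => x; rewrite -(sdotxx x) phiE ?sphereP// (bigD1 j)//=.
  set s := \sum_(_ | _) _.
  have s0 : 0 <= s by apply: sumr_ge0 => i _; rewrite -expr2 sqr_ge0.
  move: s s0 (phi j _) => s s0 u; have := sqr_ge0 (u + 1); have := sqr_ge0 (u - 1).
  have := sqr_ge0 u; rewrite !expr2 ler_norml => h1 h2 h3; rewrite sdotxx; apply/andP; split; nra.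
by move=> x y; rewrite phiE ?sphereP.
Qed.

End SphereMeasure.

(** * Designs and averages over the sphere *)

Section Averages.
Variables (R : realType) (n : nat) (hn : (2 <= n)%N).
Notation S := (sphere R hn).
Implicit Types (q : {poly R}) (mu : probability S R).

Definition zonal_sq k : {poly R} := \poly_(i < k./2.+1) zcoef R n k (2 * i + odd k).

Lemma zonal_sqE k : zonal R n k = 'X^(odd k) * (zonal_sq k \Po 'X^2).
Proof.
apply/polyP => d; rewrite coef_zonal coefXnM.
case: ltnP => [dk|kd]; first by rewrite zcoef_parity//; case: (odd k) dk => //=; case: d.
rewrite coef_comp_poly_Xn// dvdn2 oddB// oddb; case: ifP => od; last first.
  by rewrite zcoef_parity//; apply/negP => /eqP e; rewrite e addbb in od.
rewrite coef_poly divn2.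
have dE : d = (2 * (d - odd k)./2 + odd k)%N.
  have := odd_double_half (d - odd k); rewrite oddB// oddb (negbTE od) add0n -mul2n => ->.
  by rewrite subnK.
case: ltnP => [_|h]; first by rewrite -dE.
rewrite zcoef_gt//; have := odd_double_half k; rewrite -mul2n.
by move: h dE; move: (d - odd k)./2 => u; lia.
Qed.

Lemma size_zonal_sq k : size (zonal_sq k) = k./2.+1.
Proof.
rewrite size_poly_eq//= (_ : (2 * k./2 + odd k)%N = k) ?zcoef_neq0//.
by rewrite mul2n addnC odd_double_half.
Qed.

(** Stands for the average of q((x . y)^2) over y in the sphere, for the rotation
    invariant probability and any x. *)
Definition sphere_average q := gegenbauer_int hn (q \Po 'X^2) / gegenbauer_int hn 1.

Lemma gegenbauer_int1_gt0 : 0 < gegenbauer_int hn (1 : {poly R}).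
Proof. by apply: gegenbauer_int_gt0 => [|t _]; rewrite ?oner_neq0// hornerC ler01. Qed.

Lemma sphere_average_is_linear : scalar sphere_average.
Proof.
by move=> a p q; rewrite /sphere_average comp_polyD comp_polyZ linearD linearZ /= mulrDl mulrA.
Qed.
HB.instance Definition _ := GRing.isLinear.Build R {poly R} R _ sphere_average sphere_average_is_linear.

Lemma sphere_average1 : sphere_average 1 = 1.
Proof. by rewrite /sphere_average comp_polyC divff// gt_eqF// gegenbauer_int1_gt0. Qed.

Lemma sphere_average_zonal l : (0 < l)%N -> sphere_average (zonal_sq (2 * l)) = 0.
Proof.
move=> l0; rewrite /sphere_average; have := zonal_sqE (2 * l); rewrite oddM /= expr0 mul1r => <-.
by rewrite -[zonal _ _ _]mulr1 gegenbauer_int_zonal ?mul0r// size_poly1 muln_gt0.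
Qed.

Lemma even_zonal_span m q : (size q <= m)%N ->
  exists e : nat -> R, q = \sum_(l < m) e l *: zonal_sq (2 * l).
Proof.
move=> sq; apply: (@poly_triangular_span R (fun l => zonal_sq (2 * l)) m q) => // l _.
by rewrite size_zonal_sq mul2n doubleK.
Qed.

Lemma horner_sq q t : (q \Po 'X^2).[t] = q.[t ^+ 2].
Proof. by rewrite horner_comp hornerXn. Qed.

Definition poly_energy mu q := \int[(mu \x mu)%E]_z q.[sdot z.1 z.2 ^+ 2].

Lemma poly_energyE mu q : poly_energy mu q = \int[mu]_x \int[mu]_y q.[sdot x y ^+ 2].
Proof. by rewrite /poly_energy -(iterated_integral mu mu (bdd_meas_poly_dot hn q)). Qed.

Lemma poly_energy_is_linear mu : scalar (poly_energy mu).
Proof.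
move=> a p q; rewrite /poly_energy.
have m1 := product_setT mu mu.
rewrite -(expectZ m1)//; last exact: bdd_meas_poly_dot.
rewrite -(expectD m1); [|by apply: bdd_measZ; exact: bdd_meas_poly_dot|exact: bdd_meas_poly_dot].
by apply: eq_Rintegral => z _; rewrite hornerD hornerZ.
Qed.
HB.instance Definition _ mu := GRing.isLinear.Build R {poly R} R _ (poly_energy mu) (poly_energy_is_linear mu).

Lemma poly_energy1 mu : poly_energy mu 1 = 1.
Proof.
rewrite /poly_energy; under eq_Rintegral do rewrite hornerC.
by apply: expect_cst; exact: product_setT.
Qed.

Lemma gegenbauer_evenE l : gegenbauer R n (2 * l) =
  (zonal R n (2 * l)).[1]^-1 *: (zonal_sq (2 * l) \Po 'X^2).
Proof.
by rewrite gegenbauerE// /nzonal {2}zonal_sqE oddM /= expr0 mul1r.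
Qed.

Lemma design_term mu l : \int[mu]_x \int[mu]_y (gegenbauer R n (2 * l)).[sdot x y] =
  (zonal R n (2 * l)).[1]^-1 * poly_energy mu (zonal_sq (2 * l)).
Proof.
have <- : poly_energy mu ((zonal R n (2 * l)).[1]^-1 *: zonal_sq (2 * l)) =
  (zonal R n (2 * l)).[1]^-1 * poly_energy mu (zonal_sq (2 * l)) by exact: linearZ.
rewrite poly_energyE; apply: eq_Rintegral => x _.
apply: eq_Rintegral => y _.
by rewrite gegenbauer_evenE !hornerZ horner_sq.
Qed.

(** The even zonal polynomials form a basis of the even polynomials, and all of them
    but the constant average to 0. *)
Lemma is_designP mu m : (0 < m)%N ->
  is_design (m - 1) mu <-> (forall q, (size q <= m)%N -> poly_energy mu q = sphere_average q).
Proof.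
move=> m0; split=> [des q sq|h l /andP[l0 lm]]; last first.
  rewrite design_term h ?sphere_average_zonal ?mulr0//.
  by rewrite size_zonal_sq mul2n doubleK; lia.
have [e ->] := even_zonal_span sq; rewrite !linear_sum /=; apply: eq_bigr => -[l lm] _ /=.
rewrite !linearZ /=; congr (_ * _); case: (posnP l) => [->|l0].
  have -> : zonal_sq (2 * 0) = 1.
    by apply/polyP => i; rewrite coef_poly coefC; case: i => [|i].
  by rewrite poly_energy1 sphere_average1.
rewrite sphere_average_zonal//; have := des l; rewrite design_term l0 /=.
have -> : (l <= m - 1)%N by lia.
move=> /(_ isT)/eqP; rewrite mulf_eq0 invr_eq0 (negbTE (zonal1_neq0 R hn _)) /=.
by move=> /eqP.
Qed.

Section Design.
Variables (m : nat) (m0 : (0 < m)%N) (N : nat) (CW : weighted_code R S N).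
Hypothesis CW_design : is_weighted_design (m - 1) CW.
Notation w := (code_wt CW).
Notation pt := (code_pt CW).

Lemma poly_energy_kappa q : (size q <= m)%N -> poly_energy (kappa CW) q = sphere_average q.
Proof. by move=> sq; apply: (is_designP _ m0).1. Qed.

Lemma psd_zonal_sq l : psd_kernel n ((zonal R n (2 * l)).[1]^-1 *: (zonal_sq (2 * l) \Po 'X^2)).
Proof.
have := psd_zonal R hn (2 * l); rewrite /nzonal {2}zonal_sqE oddM /= expr0.
by rewrite mul1r.
Qed.

Lemma feature_integral mu (J : finType) (g : J -> S -> R) (q : {poly R}) :
  (forall j, bdd_meas (g j)) -> (forall x y, q.[sdot x y] = \sum_j g j x * g j y) ->
  \int[mu]_x \int[mu]_y q.[sdot x y] = \sum_j (\int[mu]_x g j x) ^+ 2.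
Proof.
move=> bg gE; have m1 := probability_setT mu.
transitivity (\int[mu]_x \sum_j (\int[mu]_y g j y) * g j x).
  apply: eq_Rintegral => x _; under eq_Rintegral do rewrite gE.
  rewrite (expect_sum m1); last by move=> j; exact: bdd_measZ.
  by apply: eq_bigr => j _; rewrite (expectZ m1)// mulrC.
rewrite (expect_sum m1); last by move=> j; exact: bdd_measZ.
by apply: eq_bigr => j _; rewrite (expectZ m1)// expr2.
Qed.

(** The double integral of a zonal kernel is the sum of the squared integrals of its
    features.  If it is 0, every feature integrates to 0, so that the design
    averages correctly from each single point x. *)
Lemma design_average q (x : S) : (size q <= m)%N ->
  \sum_(j < N) w j * q.[sdot x (pt j) ^+ 2] = sphere_average q.
Proof.
move=> sq; have [e ->] := even_zonal_span sq.
rewrite linear_sum /=; under eq_bigr do rewrite horner_sum mulr_sumr.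
rewrite exchange_big /=; apply: eq_bigr => -[l lm] _ /=.
rewrite linearZ /=; under eq_bigr do rewrite hornerZ mulrCA.
rewrite -mulr_sumr; congr (_ * _); case: (posnP l) => [->|l0].
  have -> : zonal_sq (2 * 0) = 1.
    by apply/polyP => i; rewrite coef_poly coefC; case: i => [|i].
  rewrite sphere_average1; under eq_bigr do rewrite hornerC mulr1.
  exact: code_wt_sum.
rewrite sphere_average_zonal//.
have [J [g [bg gE]]] := psd_features hn (psd_zonal_sq l).
have : \sum_j (\int[kappa CW]_x g j x) ^+ 2 = 0.
  rewrite -(feature_integral (kappa CW) bg gE).
  have := CW_design (l := l); rewrite l0 /=; have -> : (l <= m - 1)%N by lia.
  by move=> /(_ isT); under eq_Rintegral do under eq_Rintegral do rewrite gegenbauer_evenE.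
move=> /eqP; rewrite psumr_eq0 => [/allP g0|j _]; last exact: sqr_ge0.
have B0 j : \sum_(i < N) w i * g j (pt i) = 0.
  have := g0 j (mem_index_enum _); rewrite /= sqrf_eq0 => /eqP.
  by rewrite (kappa_integral CW (bg j)).
have c0 : (zonal R n (2 * l)).[1]^-1 != 0 by rewrite invr_eq0 zonal1_neq0.
apply: (mulfI c0); rewrite mulr0 mulr_sumr.
transitivity (\sum_j g j x * \sum_(i < N) w i * g j (pt i)).
  rewrite (eq_bigr (fun i => \sum_j g j x * (w i * g j (pt i)))); last first.
    move=> i _; rewrite mulrCA -horner_sq -hornerZ gE mulr_sumr.
    by apply: eq_bigr => j _; rewrite mulrCA.
  by rewrite exchange_big; apply: eq_bigr => j _; rewrite mulr_sumr.
by rewrite big1// => j _; rewrite B0 mulr0.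
Qed.

(** Positive semidefiniteness is used for the signed measure mu - kappa.  By
    exactness of the design the mixed term and the kappa term both equal the
    average, so that the code takes the place of the uniform measure. *)
Lemma psd_energy q mu : psd_kernel n (q \Po 'X^2) -> (size q <= m)%N ->
  sphere_average q <= poly_energy mu q.
Proof.
move=> pq sq; have [J [g [bg gE]]] := psd_features hn pq.
pose A j := \int[mu]_x g j x; pose B j := \sum_(i < N) w i * g j (pt i).
have AA : poly_energy mu q = \sum_j A j ^+ 2.
  rewrite -(feature_integral mu bg gE) poly_energyE.
  by under [RHS]eq_Rintegral do under eq_Rintegral do rewrite horner_sq.
have gB x : \sum_j B j * g j x = sphere_average q.
  rewrite -(design_average x sq).
  under eq_bigr do rewrite mulr_suml.
  rewrite exchange_big; apply: eq_bigr => i _ /=.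
  rewrite -horner_sq gE mulr_sumr; apply: eq_bigr => j _; ring.
have AB : \sum_j B j * A j = sphere_average q.
  have m1 := probability_setT mu.
  rewrite -[RHS](expect_cst m1).
  transitivity (\int[mu]_x \sum_j B j * g j x); last by apply: eq_Rintegral => x _; exact: gB.
  rewrite (expect_sum m1); last by move=> j; exact: bdd_measZ.
  by apply: eq_bigr => j _; rewrite (expectZ m1).
have BB : \sum_j B j ^+ 2 = sphere_average q.
  transitivity (\sum_(i < N) w i * sphere_average q); last first.
    by rewrite -mulr_suml code_wt_sum mul1r.
  rewrite (eq_bigr (fun i => \sum_j w i * (B j * g j (pt i)))); last first.
    by move=> i _; rewrite -(gB (pt i)) mulr_sumr.
  rewrite exchange_big; apply: eq_bigr => j _.
  by rewrite expr2 {2}/B mulr_sumr; apply: eq_bigr => i _; ring.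
have : 0 <= \sum_j (A j - B j) ^+ 2 by apply: sumr_ge0 => j _; exact: sqr_ge0.
have -> : \sum_j (A j - B j) ^+ 2 = \sum_j A j ^+ 2 - 2 * (\sum_j B j * A j) + \sum_j B j ^+ 2.
  by rewrite mulr_sumr -sumrB -big_split; apply: eq_bigr => j _ /=; ring.
rewrite AB BB -AA; lra.
Qed.

End Design.
End Averages.

(** * The nodes and their partial products *)

Section SymmetricNodes.
Variable R : realType.

Lemma size_count_sign (s : seq R) :
  size s = (count (fun t => 0 < t)%R s + count (fun t => t < 0)%R s + count_mem 0%R s)%N.
Proof.
elim: s => //= t s ->; case: (ltgtP t 0) => //= _; lia.
Qed.

(** Squaring identifies opposite elements of A, and 0 is its own opposite; this is
    where the parity e of m comes from. *)
Lemma symmetric_nodes (m : nat) (alpha : 'I_m -> R) :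
  (forall i, -1 < alpha i < 1) ->
  (forall i j : 'I_m, (i < j)%N -> alpha i < alpha j) ->
  (forall t : R, range alpha t -> range alpha (- t)) ->
  exists (e : bool) (B : seq R), [/\ sorted <%R B, (forall b, b \in B -> 0 < b < 1),
    (m = e + 2 * size B)%N &
    forall t : R, -1 < t < 1 -> range alpha t <-> t ^+ 2 \in nseq e 0 ++ B].
Proof.
move=> bnd incr sym.
have inj : injective alpha.
  move=> i j ij; apply/val_inj; case: (ltngtP i j) => // /incr; by rewrite ij ltxx.
pose al := [seq alpha i | i <- enum 'I_m].
have ual : uniq al by rewrite map_inj_uniq// enum_uniq.
have alP t : (t \in al) <-> range alpha t.
  split=> [/mapP[i _ ->]|[i _ <-]]; first by exists i.
  by apply: map_f; rewrite mem_enum.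
have alN t : (- t \in al) = (t \in al).
  apply/idP/idP => /alP /sym /alP //; by rewrite opprK.
pose pos := [seq t <- al | 0 < t]; pose B := [seq t ^+ 2 | t <- sort <=%R pos].
have sB : sorted <%R B.
  apply: (@homo_sorted_in R R [pred t | 0 < t] (fun t : R => t ^+ 2) <%R <%R).
  - by move=> x y; rewrite !inE => x0 y0 xy; rewrite ltr_pXn2r ?nnegrE// ltW.
  - by rewrite all_sort; apply/allP => t; rewrite mem_filter => /andP[].
  - by rewrite lt_sorted_uniq_le sort_uniq filter_uniq// sort_le_sorted.
have BP b : b \in B <-> exists2 t, t \in pos & b = t ^+ 2.
  split=> [/mapP[t]|[t tp ->]]; first by rewrite mem_sort => tp ->; exists t.
  by apply: map_f; rewrite mem_sort.
have alb t : t \in al -> -1 < t < 1 by move=> /mapP[i _ ->].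
exists (0 \in al), B; split=> //.
- move=> b /BP[t]; rewrite mem_filter => /andP[t0 /alb /andP[_ t1]] ->.
  by rewrite exprn_gt0//= expr_lt1// ltW.
- rewrite /B size_map size_sort.
  have -> : m = size al by rewrite size_map size_enum_ord.
  have nE : count (fun t => t < 0)%R al = size pos.
    rewrite -size_filter -(size_map -%R pos); apply: perm_size; apply: uniq_perm.
    - exact: filter_uniq.
    - by rewrite map_inj_uniq ?filter_uniq//; exact: oppr_inj.
    - move=> t; rewrite mem_filter; apply/idP/idP => [/andP[t0 ta]|/mapP[u]].
        by apply/mapP; exists (- t); rewrite ?opprK// mem_filter oppr_gt0 t0 alN.
      by rewrite mem_filter => /andP[u0 ua] ->; rewrite oppr_lt0 u0 alN.
  have pE : size pos = count (fun t => 0 < t)%R al by exact: size_filter.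
  rewrite [LHS]size_count_sign nE count_uniq_mem// -pE.
  by move: (size pos) (0 \in al) => u v; lia.
move=> t t1; have memE : (t ^+ 2 \in nseq (0 \in al) 0 ++ B) = (t \in al).
  rewrite mem_cat mem_nseq; apply/idP/idP => [/orP[/andP[z /eqP]|/BP[u]]|ta].
  - by move/eqP; rewrite sqrf_eq0 => /eqP ->; case: (0 \in al) z.
  - rewrite mem_filter => /andP[_ ua] /eqP; rewrite eqf_sqr => /orP[/eqP ->//|/eqP ->].
    by rewrite alN.
  - have [t0|t0|t0] := ltgtP t 0.
    + by apply/orP; right; apply/BP; exists (- t); rewrite ?sqrrN// mem_filter oppr_gt0 t0 alN.
    + by apply/orP; right; apply/BP; exists t; rewrite // mem_filter t0.
    + by rewrite t0 expr0n eqxx andbT -t0 ta.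
by rewrite memE; split=> /alP.
Qed.
End SymmetricNodes.

Section PartialProducts.
Variables (R : realType) (n : nat) (hn : (2 <= n)%N).
Notation S := (sphere R hn).
Variables (m : nat) (m0 : (0 < m)%N) (N : nat) (CW : weighted_code R S N).
Hypothesis CW_design : is_weighted_design (m - 1) CW.
Notation w := (code_wt CW).
Notation pt := (code_pt CW).
Variables (e : bool) (B : seq R).
Hypotheses (sB : sorted <%R B) (B01 : forall b, b \in B -> 0 < b < 1).
Hypothesis mE : (m = e + 2 * size B)%N.
Hypothesis CW_sqr : forall i j, sdot (pt i) (pt j) ^+ 2 \in rcons (nseq e 0 ++ B) 1.

Let i0 : 'I_N := Ordinal (code_size_gt0 CW).
Let s j := sdot (pt i0) (pt j) ^+ 2.
Let bs := rcons B 1.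
Let lam b := \sum_(j < N | s j == b) w j * b ^+ e.
Let L := node_sum bs lam.

Let sbs : sorted <%R bs.
Proof.
rewrite /bs; case: B sB B01 => [//|b B'] /= sB' b1.
by rewrite rcons_path sB' /=; have /andP[] := b1 _ (mem_last b B').
Qed.

Let ubs : uniq bs := sorted_uniq lt_trans (@ltxx _ _) sbs.

(** The design averages from the chosen point of the code, and the squared dot
    products seen from there are the nodes and 1.  The factor 'X^e removes the
    node 0 when it is present. *)
Lemma discrete_exact q : (size ('X^e * q)%R <= m)%N -> L q = sphere_average hn ('X^e * q).
Proof.
move=> sq; rewrite -(design_average m0 CW_design (pt i0) sq) /L /node_sum.
have key j : \sum_(b <- bs | s j == b) w j * b ^+ e * q.[b] =
    w j * ('X^e * q).[sdot (pt i0) (pt j) ^+ 2].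
  rewrite hornerM hornerXn -/(s j) mulrA.
  have := CW_sqr i0 j; rewrite -/(s j) -cats1 -catA cats1 -/bs mem_cat => /orP[|sbs'].
    rewrite mem_nseq lt0b => /andP[e1 /eqP ->]; rewrite e1 expr1 mulr0 mul0r.
    by apply: big1 => b /eqP <-; rewrite expr1 mulr0 mul0r.
  rewrite (big_rem (s j))//= eqxx big1_seq ?addr0// => b /andP[/eqP <-].
  by rewrite mem_rem_uniq// inE eqxx.
transitivity (\sum_(b <- bs) \sum_(j < N | s j == b) w j * b ^+ e * q.[b]).
  by apply: eq_bigr => b _; rewrite /lam mulr_suml.
rewrite (exchange_big_dep xpredT)//=; apply: eq_bigr => j _; exact: key.
Qed.

Lemma sphere_average_gt0 (q : {poly R}) : q != 0 ->
  (forall t, t \in `[0, 1] -> 0 <= q.[t]) -> 0 < sphere_average hn q.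
Proof.
move=> q0 qge; apply: divr_gt0; last exact: gegenbauer_int1_gt0.
apply: gegenbauer_int_gt0.
  by rewrite comp_poly_eq0 ?size_polyXn.
move=> t; rewrite in_itv/= => /andP[t1 t2]; rewrite horner_sq; apply: qge.
by rewrite in_itv/= sqr_ge0 /=; nra.
Qed.

(** The quadrature is exact on 'X^e (1 - 'X) times the square of the polynomial
    vanishing at the other nodes, and the average of that product is positive. *)
Lemma lam_gt0 b : b \in bs -> 0 < lam b.
Proof.
have lam_ge0 : 0 <= b ^+ e -> 0 <= lam b.
  by move=> b0; apply: sumr_ge0 => j _; rewrite mulr_ge0// ltW// code_wt_gt0.
rewrite mem_rcons inE => /predU1P[->|bB].
  rewrite /lam (bigD1 i0)/=; last by rewrite /s sdotxx expr1n.
  rewrite expr1n mulr1 ltr_pwDl ?code_wt_gt0//.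
  by apply: sumr_ge0 => j _; rewrite mulr1 ltW// code_wt_gt0.
have /andP[b0 b1] := B01 bB.
pose g := \prod_(c <- rem b B) ('X - c%:P); pose q := (1 - 'X) * g ^+ 2.
have g0 : g != 0 by rewrite monic_neq0// monic_prod_XsubC.
have sg : size g = size B by rewrite size_prod_XsubC size_rem//; case: (B) bB.
have uB : uniq B by move: ubs; rewrite rcons_uniq => /andP[].
have q0 : 'X^e * q != 0.
  rewrite !mulf_neq0 ?expf_neq0 ?polyX_eq0//.
  by rewrite -opprB oppr_eq0 -polyC1 polyXsubC_eq0.
have sq : (size ('X^e * q)%R <= m)%N.
  apply: leq_trans (size_polyMleq _ _) _; rewrite size_polyXn /=.
  have h1 : (size q <= (size (g ^+ 2)%R).+1)%N.
    apply: leq_trans (size_polyMleq _ _) _.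
    by rewrite -opprB size_polyN -polyC1 size_XsubC.
  have h2 : (size (g ^+ 2)%R <= (size g + size g).-1)%N.
    by apply: leq_trans (size_polyMleq _ _) _.
  have B0 : (0 < size B)%N by case: (B) bB.
  move: h1 h2 B0; rewrite sg mE; move: (size q) (size _) (size B) => u v z.
  by move: (nat_of_bool e) => c; lia.
have : 0 < L q.
  rewrite discrete_exact//; apply: sphere_average_gt0 => // t; rewrite in_itv/= => /andP[t0 t1].
  rewrite hornerM hornerXn hornerM hornerD hornerN hornerX -polyC1 hornerC horner_exp.
  apply: mulr_ge0; first by rewrite exprn_ge0.
  by apply: mulr_ge0; [rewrite subr_ge0|exact: sqr_ge0].
have -> : L q = lam b * q.[b].
  rewrite /L /node_sum (big_rem b)/=; last by rewrite mem_rcons inE bB orbT.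
  rewrite big1_seq ?addr0// => c /andP[_]; rewrite mem_rem_uniq// inE => /andP[cb].
  rewrite mem_rcons inE => /predU1P[->|cB].
    by rewrite /q hornerM hornerD hornerN hornerX -polyC1 hornerC subrr mul0r mulr0.
  rewrite /q hornerM horner_exp (_ : g.[c] = 0) ?expr0n ?mulr0//.
  by apply/rootP; rewrite root_prod_XsubC mem_rem_uniq// inE cb.
have qb : 0 <= q.[b].
  rewrite /q hornerM hornerD hornerN hornerX -polyC1 hornerC horner_exp.
  by rewrite mulr_ge0 ?sqr_ge0// subr_ge0 ltW.
have l0 : 0 <= lam b by apply: lam_ge0; rewrite exprn_ge0// ltW.
move=> h; rewrite lt_neqAle l0 andbT; apply/negP => /eqP l00.
by rewrite -l00 mul0r ltxx in h.
Qed.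

Let Lpos : posdef L (size bs).
Proof. by apply: node_sum_posdef => // b; exact: lam_gt0. Qed.

(** Exactness transfers orthogonality from the discrete measure to the sphere, up to
    degree size B.  The factor is positive because both polynomials are positive
    at 1, the right end of the discrete support. *)
Lemma isOP_zonal_sq i p : (i < size bs)%N -> isOP L i p ->
  exists2 c : R, 0 < c & 'X^e * (p \Po 'X^2) = c *: nzonal R n (2 * i + e).
Proof.
move=> ib hp; have [mp sp op] := hp.
(* Matching leading coefficients, d is the difference of the two polynomials; it
   has degree less than i and its square averages to 0. *)
have {}ib : (i <= size B)%N by rewrite size_rcons in ib.
have okE : odd (2 * i + e) = e :> bool by rewrite oddD oddM /= oddb.
have hk : ((2 * i + e)./2 = i)%N.
  by have := odd_double_half (2 * i + e); rewrite okE -mul2n => ?; lia.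
pose z := zonal_sq R n (2 * i + e).
have sz : size z = i.+1 by rewrite size_zonal_sq// hk.
have lz : lead_coef z != 0 by rewrite lead_coef_eq0 -size_poly_eq0 sz.
pose c := (lead_coef z)^-1.
have sd : (size (p - c *: z)%R <= i)%N.
  apply: size_monicB => //; rewrite ?size_scale ?invr_eq0//.
  by rewrite monicE lead_coefZ mulVf.
set d := p - c *: z in sd.
have zE : 'X^e * (z \Po 'X^2) = zonal R n (2 * i + e) by rewrite [RHS]zonal_sqE// okE.
have Ld0 : sphere_average hn ('X^e * d ^+ 2) = 0.
  have -> : 'X^e * d ^+ 2 = 'X^e * (p * d) - c *: ('X^e * (z * d)).
    by rewrite expr2 {1}/d -!mul_polyC; ring.
  have -> : sphere_average hn ('X^e * (p * d) - c *: ('X^e * (z * d))) =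
      sphere_average hn ('X^e * (p * d)) - c * sphere_average hn ('X^e * (z * d)).
    by rewrite raddfB /= [X in _ - X]linearZ.
  have -> : sphere_average hn ('X^e * (p * d)) = 0.
    rewrite -discrete_exact; first by rewrite op.
    have [->|d0] := eqVneq d 0; first by rewrite !mulr0 size_poly0.
    apply: leq_trans (size_polyMleq _ _) _; rewrite size_polyXn /=.
    have : (size (p * d)%R <= (size p + size d).-1)%N by exact: size_polyMleq.
    have : (0 < size d)%N by rewrite size_poly_gt0.
    move: sd ib; rewrite sp mE; move: (size _) (size _) (size _) => u v t.
    by move: (nat_of_bool e) => a; lia.
  have -> : sphere_average hn ('X^e * (z * d)) = 0.
    rewrite /sphere_average; apply/eqP; rewrite mulf_eq0; apply/orP; left; apply/eqP.
    have -> : ('X^e * (z * d)) \Po 'X^2 = zonal R n (2 * i + e) * ('X^e * (d \Po 'X^2)).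
      rewrite -zE !comp_polyM rmorphXn /= comp_polyX -exprM mul2n -addnn exprD; ring.
    apply: gegenbauer_int_zonal.
    have [->|d0] := eqVneq d 0; first by rewrite comp_poly0 mulr0 size_poly0.
    apply: leq_trans (size_polyMleq _ _) _; rewrite size_polyXn /=.
    have := size_comp_poly d ('X^2 : {poly R}); rewrite size_polyXn /=.
    have : (0 < size d)%N by rewrite size_poly_gt0.
    move: sd; move: (size _) (size _) => u v.
    by move: (nat_of_bool e) => a; lia.
  by rewrite mulr0 subr0.
have d0 : d = 0.
  apply/eqP/negP => /negP d0; suff : 0 < sphere_average hn ('X^e * d ^+ 2) by rewrite Ld0 ltxx.
  apply: sphere_average_gt0; first by rewrite mulf_neq0 ?expf_neq0 ?polyX_eq0.
  move=> t; rewrite in_itv/= => /andP[t0 _].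
  rewrite hornerM hornerXn horner_exp; apply: mulr_ge0; last exact: sqr_ge0.
  by rewrite exprn_ge0.
have pE : p = c *: z by apply/eqP; rewrite -subr_eq0 -/d d0.
have z1 : (zonal R n (2 * i + e)).[1] != 0 by exact: zonal1_neq0.
exists (c * (zonal R n (2 * i + e)).[1]).
  have := isOP_right_gt0 sbs lam_gt0 (l := i) (p := p).
  rewrite ltnS => /(_ ib hp); rewrite pE hornerZ.
  by rewrite -zE hornerM hornerXn expr1n mul1r horner_sq expr1n.
by rewrite /nzonal scalerA mulfK// pE comp_polyZ -zE -scalerAr.
Qed.

(** The polynomials q for which t^e q(t^2) is positive semidefinite form a convex
    cone that contains the orthogonal polynomials of the discrete measure. *)
Lemma psd_prefix_prod k : (k <= size B)%N ->
  psd_kernel n ('X^e * ((\prod_(b <- take k B) ('X - b%:P)) \Po 'X^2)).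
Proof.
move=> kB; pose C (q : {poly R}) := psd_kernel n ('X^e * (q \Po 'X^2)).
have := @cone_prefix_prod R bs lam C sbs lam_gt0 _ _ _ _ k.
rewrite /bs size_rcons ltnS -cats1 takel_cat//; apply=> //.
- rewrite /C comp_poly0 mulr0; exact: psdC.
- by move=> p q hp hq; rewrite /C comp_polyD mulrDr; exact: psdD.
- by move=> c p c0 hp; rewrite /C comp_polyZ -scalerAr; exact: psdZ.
- move=> i p ib; rewrite cats1 -/bs => hp.
  have ib' : (i < size bs)%N by move: ib; rewrite !(size_rcons, size_cat) ?addn1.
  have [c c0 cE] := isOP_zonal_sq ib' hp; rewrite /C cE.
  by apply: psdZ; [exact: ltW|exact: psd_zonal].
Qed.

Lemma psdXn k : psd_kernel n ('X^k : {poly R}).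
Proof.
elim: k => [|k IH]; first by rewrite expr0 -polyC1; exact: psdC.
by rewrite exprS; apply: psdM => //; exact: psdX.
Qed.

(** With g the product over all of B, a product over more than e + size B nodes is
    t^e g(t^2) times t^e times a prefix product, and kernels can be multiplied; for
    fewer nodes one multiplies a prefix product by a power of t. *)
Lemma psd_nodal k : (k < m)%N -> psd_kernel n (nodal ((nseq e 0 ++ B) ++ B) k \Po 'X^2).
Proof.
move=> km.
have dbl j : (j <= 2 * size B)%N -> psd_kernel n ('X^e * 'X^e * (nodal (B ++ B) j \Po 'X^2)).
  move=> jB; have [jle|jgt] := leqP j (size B).
    rewrite -mulrA; apply: psdM; first exact: psdXn.
    by rewrite /nodal takel_cat//; exact: psd_prefix_prod.
  rewrite /nodal take_cat ltnNge (ltnW jgt) /= big_cat /= comp_polyM mulrACA.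
  apply: psdM; last by apply: psd_prefix_prod; lia.
  by have := psd_prefix_prod (leqnn (size B)); rewrite take_size.
move: km; rewrite mE; move: dbl.
case: (e) => /= dbl km; last first.
  have := dbl k; rewrite expr0 !mul1r add0n in km *; apply; exact: ltnW.
case: k km => [|j] km.
  by rewrite /nodal take0 big_nil -polyC1 comp_polyC; exact: psdC.
have := dbl j; rewrite expr1 -expr2 /nodal /= big_cons subr0 comp_polyM comp_polyX.
by apply; lia.
Qed.

End PartialProducts.

(** * The Hermite minorant and the energy bound *)

Section Minorant.
Variables (R : realType) (m : nat) (f : R -> R) (e : bool) (B : seq R).
Hypothesis f_cont : {within `[0, 1], continuous f}.
Hypothesis f_deriv : forall k : nat, (1 <= k <= m)%N -> forall t : R, t \in `]0, 1[ ->
  derivable (derive1n k.-1 f) t 1 /\ 0 <= derive1n k f t.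
Hypotheses (sB : sorted <%R B) (B01 : forall b, b \in B -> 0 < b < 1).
Hypothesis (mE : (m = e + 2 * size B)%N).
Hypothesis m0 : (0 < m)%N.

Let Z := nseq e 0 ++ B.

Lemma nodes_sorted : sorted <%R Z.
Proof.
rewrite /Z; case: (e) => //=; rewrite lt_path_sortedE sB andbT.
by apply/allP => b /B01 /andP[].
Qed.

Lemma nodes_lt1 z : z \in Z -> 0 <= z < 1.
Proof.
rewrite mem_cat mem_nseq => /orP[/andP[_ /eqP ->]|/B01 /andP[z0 ->]]; last by rewrite ltW.
by rewrite lexx ltr01.
Qed.

(** Every node but 0 occurs twice. *)
Lemma nodal_gt0 s : s \in `[0, 1] -> s \notin Z -> 0 < (nodal (Z ++ B) m).[s].
Proof.
rewrite in_itv/= => /andP[s0 s1] sZ.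
rewrite /nodal take_oversize; last by rewrite /Z !size_cat size_nseq mE; lia.
rewrite /Z -catA !big_cat /= hornerM hornerM -expr2 mulr_gt0//.
  have : e -> s != 0.
    move=> e1; apply: contra sZ => /eqP ->.
    by rewrite mem_cat mem_nseq e1 eqxx.
  case: (e) => /= [/(_ isT) sn0|_]; last by rewrite big_nil hornerC.
  by rewrite big_cons big_nil mulr1 hornerXsubC subr0 lt_neqAle eq_sym sn0.
rewrite lt_neqAle sqr_ge0 andbT eq_sym sqrf_eq0 -/(root _ _) root_prod_XsubC.
by apply: contra sZ => sB'; rewrite mem_cat sB' orbT.
Qed.

(** Newton coefficients and error quotients are derivatives of f divided by
    factorials, and the nodal polynomial is positive off the nodes. *)
Lemma hermite_minorant : exists c : nat -> R, let h := newton Z B c m in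
  [/\ (size h <= m)%N, (forall j, (0 < j < m)%N -> 0 <= c j),
      (forall z, z \in Z -> f z = h.[z]),
      (forall s, s \in `[0, 1] -> s \notin Z -> 0 <= f s - h.[s]) &
      (forall k : nat, (1 <= k <= m)%N -> forall t : R, t \in `]0, 1[ -> 0 < derive1n k f t) ->
        (forall j, (0 < j < m)%N -> 0 < c j) /\
        (forall s, s \in `[0, 1] -> s \notin Z -> 0 < f s - h.[s])].
Proof.
have dZ : {subset B <= Z} by move=> b bB; rewrite mem_cat bB orbT.
have Z01 (z : R) : z \in Z -> z \in `[0, 1].
  by move=> /nodes_lt1 /andP[z0 z1]; rewrite in_itv/= z0 ltW.
have D01 (z : R) : z \in B -> z \in `]0, 1[ by move=> /B01; rewrite in_itv.
have sZm : (size Z + size B = m)%N by rewrite /Z size_cat size_nseq [RHS]mE mul2n -addnn addnA.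
have Z0 : (0 < size Z)%N by move: m0; rewrite -sZm; case: (size Z) (sZm) => // sB0; move: sB0 mE; case: (e); rewrite ?mul2n; lia.
have uB : uniq B := sorted_uniq lt_trans (@ltxx _ _) sB.
have fd (k : nat) : (1 <= k <= m)%N -> forall t : R, t \in `]0, 1[ ->
    derivable (derive1n k.-1 f) t 1 by move=> km t t01; case: (f_deriv km t01).
have [c [hint cE]] := newton_exists f_cont fd nodes_sorted uB dZ Z01 D01 Z0 sZm.
have cE' j : (0 < j < m)%N -> exists2 x : R, x \in `]0, 1[ & c j = derive1n j f x / (j`!)%:R.
  move=> /cE [x x01 xE]; exists x => //; rewrite xE.
  by rewrite mulrC mulKf// pnatr_eq0 -lt0n fact_gt0.
have sh : (size (newton Z B c m) <= m)%N by exact: (size_newton sZm c (leqnn m)).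
have err s := newton_error f_cont fd nodes_sorted uB dZ Z01 D01 sZm hint sh (s := s).
exists c; split=> //.
- move=> j jm; have [x x01 ->] := cE' j jm; apply: divr_ge0 => //.
  have jm' : (1 <= j <= m)%N by case/andP: jm => -> /ltnW ->.
  by case: (f_deriv jm' x01).
- move=> z zZ; case: hint => + _; apply; rewrite take_oversize//.
  by rewrite -sZm leq_addr.
- move=> s s01 sZ; have [x x01 ->] := err s s01 sZ m0.
  apply: mulr_ge0; last by apply/ltW/nodal_gt0.
  by apply: divr_ge0 => //; case: (f_deriv (k := m) _ x01) => //; rewrite m0 leqnn.
move=> fpos; split.
  move=> j jm; have [x x01 ->] := cE' j jm; apply: divr_gt0; last by rewrite ltr0n fact_gt0.
  by apply: fpos => //; case/andP: jm => -> /ltnW ->.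
move=> s s01 sZ; have [x x01 ->] := err s s01 sZ m0.
apply: mulr_gt0; last exact: nodal_gt0.
by apply: divr_gt0; [apply: fpos => //; rewrite m0 leqnn|rewrite ltr0n fact_gt0].
Qed.
End Minorant.

Section DoubleKappa.
Context d (T : measurableType d) (R : realType).

Lemma bdd_meas_pair1 (G : T * T -> R) x : bdd_meas G -> bdd_meas (fun y => G (x, y)).
Proof.
move=> [mG [M bM]]; split; last by exists M => y.
exact: measurableT_comp mG (pair1_measurable x).
Qed.

Lemma bdd_meas_pair2 (G : T * T -> R) y : bdd_meas G -> bdd_meas (fun x => G (x, y)).
Proof.
move=> [mG [M bM]]; split; last by exists M => x.
exact: measurableT_comp mG (pair2_measurable y).
Qed.

Variables (N : nat) (C : weighted_code R T N).

Lemma kappa_double_integral (G : T * T -> R) : bdd_meas G ->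
  \int[(kappa C \x kappa C)%E]_z G z =
  \sum_(i < N) \sum_(j < N) code_wt C i * code_wt C j * G (code_pt C i, code_pt C j).
Proof.
move=> bG; rewrite -(iterated_integral (kappa C) (kappa C) bG).
under eq_Rintegral do rewrite (kappa_integral C (bdd_meas_pair1 _ bG)).
rewrite (kappa_integral C (h := fun x => \sum_(j < N) code_wt C j * G (x, code_pt C j))).
  by apply: eq_bigr => i _; rewrite mulr_sumr; apply: eq_bigr => j _; rewrite mulrA.
by apply: bdd_meas_sum => j; apply: bdd_measZ; exact: bdd_meas_pair2.
Qed.
End DoubleKappa.

Lemma ge0_sum3_eq0 (R : realFieldType) (a b c : R) : 0 <= a -> 0 <= b -> 0 <= c ->
  a + b + c = 0 -> [/\ a = 0, b = 0 & c = 0].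
Proof. by move=> *; split; lra. Qed.

Lemma measurable_dot_in (R : realType) (n : nat) (hn : (2 <= n)%N) (K : set R) :
  measurable K -> measurable (@dot_in R n hn K).
Proof.
move=> mK; rewrite -[dot_in K]setTI.
exact: measurable_sdot measurableT K mK.
Qed.

Unset Implicit Arguments.

Theorem theorem7p1 (R : realType) (n : nat) (hn : (2 <= n)%N)
    (m : nat) (hm : (1 <= m)%N)
    (alpha : 'I_m -> R)
    (alpha_bnd : forall i, -1 < alpha i < 1)
    (alpha_incr : forall i j : 'I_m, (i < j)%N -> alpha i < alpha j)
    (alpha_sym : forall t : R, range alpha t -> range alpha (- t))
    (N : nat) (CW : weighted_code R (sphere R hn) N)
    (CW_design : is_weighted_design (m - 1) CW)
    (CW_dot : forall i j : 'I_N,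
      (range alpha `|` [set -1; 1]) (sdot (code_pt CW i) (code_pt CW j)))
    (f : R -> R)
    (f_cont : {within `[0, 1], continuous f})
    (f_deriv : forall k : nat, (1 <= k <= m)%N ->
      forall t : R, t \in `]0, 1[ ->
        derivable (derive1n k.-1 f) t 1 /\ 0 <= derive1n k f t) :
  energy f (kappa CW) =
    \sum_(i < N) \sum_(j < N) code_wt CW i * code_wt CW j *
      f (sdot (code_pt CW i) (code_pt CW j) ^+ 2) /\
  (forall mu : probability (sphere R hn) R,
    (theta (kappa CW) <= theta mu)%E ->
    energy f (kappa CW) <= energy f mu) /\
  ((forall k : nat, (1 <= k <= m)%N ->
      forall t : R, t \in `]0, 1[ -> 0 < derive1n k f t) ->
    forall mu : probability (sphere R hn) R,
      (theta (kappa CW) <= theta mu)%E ->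
      (energy f mu = energy f (kappa CW) <->
        [/\ is_design (m - 1) mu,
            (mu \x mu)%E (dot_in (`]-1, 1[ `\` range alpha)) = 0%E &
            theta mu = theta (kappa CW)])).
Proof.
have [e [B [sB B01 mE rangeP]]] := symmetric_nodes alpha_bnd alpha_incr alpha_sym.
set Z := nseq e 0 ++ B in rangeP.
have ran_bnd t : range alpha t -> -1 < t < 1 by move=> [i _ <-]; exact: alpha_bnd.
have CW_sqr i j : sdot (code_pt CW i) (code_pt CW j) ^+ 2 \in rcons Z 1.
  rewrite mem_rcons inE; case: (CW_dot i j) => [r|[->|->]].
  - by apply/orP; right; apply/rangeP => //; exact: ran_bnd.
  - by rewrite sqrrN expr1n eqxx.
  - by rewrite expr1n eqxx.
have [c [sh c_ge0 fZ err_ge0 strict]] := hermite_minorant f_cont f_deriv sB B01 mE hm.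
rewrite -/Z in sh fZ err_ge0 strict *; set h := newton Z B c m in sh fZ err_ge0 strict.
have one01 : (1 : R) \in `[0, 1] by rewrite in_itv/= ler01 lexx.
have oneZ : (1 : R) \notin Z.
  by apply/negP => /(nodes_lt1 B01) /andP[_]; rewrite ltxx.
pose gap := f 1 - h.[1].
have gap_ge0 : 0 <= gap by exact: err_ge0.
pose K : set (sphere R hn * sphere R hn) := dot_in [set -1; 1].
have mK : measurable K.
  by apply: measurable_dot_in; apply: measurableU; exact: measurable_set1.
have bK : bdd_meas (\1_K : sphere R hn * sphere R hn -> R) by exact: bdd_meas_indic.
have KE (z : sphere R hn * sphere R hn) : K z <-> sdot z.1 z.2 ^+ 2 = 1.
  rewrite /K /dot_in /=; split=> [[->|->]|/eqP]; rewrite ?sqrrN ?expr1n//.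
  by rewrite sqrf_eq1 => /orP[/eqP|/eqP] ->; [right|left].
have bf : bdd_meas (fun z : sphere R hn * sphere R hn => f (sdot z.1 z.2 ^+ 2)).
  apply: bdd_meas_dot.
    by apply: subspace_continuous_measurable_fun => //; exact: measurable_itv.
  have [||u _ hu] := @EVT_max R (fun t : R => `|f t|) 0 1; first exact: ler01.
    by move=> x; apply: cvg_norm; exact: f_cont.
  by exists `|f u|.
have bh := bdd_meas_poly_dot hn h.
(* The minorant h + gap * 1_(s = 1) agrees with f at the nodes and at 1; the mass
   of the jump is theta. *)
pose D (z : sphere R hn * sphere R hn) :=
  f (sdot z.1 z.2 ^+ 2) - h.[sdot z.1 z.2 ^+ 2] - gap * \1_K z.
have bD : bdd_meas D by apply: bdd_measB; [exact: bdd_measB|exact: bdd_measZ].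
have DE z : D z = if sdot z.1 z.2 ^+ 2 == 1 then 0
    else f (sdot z.1 z.2 ^+ 2) - h.[sdot z.1 z.2 ^+ 2].
  rewrite /D indicE; case: eqP => [s1|s1].
    by rewrite mem_set ?KE// s1 mulr1 subrr.
  by rewrite memNset ?KE//= mulr0 subr0.
have D_ge0 z : 0 <= D z.
  rewrite DE; case: ifP => // _; have [sZ|sZ] := boolP (sdot z.1 z.2 ^+ 2 \in Z).
    by rewrite fZ// subrr.
  by apply: err_ge0 => //; exact: sdot_sqr_bound.
have energyE (mu : probability (sphere R hn) R) : energy f mu = \int[(mu \x mu)%E]_z f (sdot z.1 z.2 ^+ 2).
  by rewrite -(iterated_integral mu mu bf).
have thetaE (mu : probability (sphere R hn) R) : \int[(mu \x mu)%E]_z (\1_K z : R) = fine (theta mu).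
  by rewrite /Rintegral integral_indic// setIT.
have theta_fin (mu : probability (sphere R hn) R) : theta mu \is a fin_num.
  rewrite ge0_fin_numE// (@le_lt_trans _ _ 1%E) ?ltry//.
  rewrite -(product_setT mu mu); apply: le_measure; rewrite ?inE//.
have split_energy (mu : probability (sphere R hn) R) :
    energy f mu = poly_energy mu h + gap * fine (theta mu) + \int[(mu \x mu)%E]_z D z.
  have M1 := product_setT mu mu.
  rewrite energyE -thetaE -(expectZ M1)// /poly_energy -(expectD M1)//; last exact: bdd_measZ.
  rewrite -(expectD M1)//; last by apply: bdd_measD => //; exact: bdd_measZ.
  by apply: eq_Rintegral => z _; rewrite /D; ring.
have psd_gap (mu : probability (sphere R hn) R) j : (j < m)%N ->
    sphere_average hn (nodal (Z ++ B) j) <= poly_energy mu (nodal (Z ++ B) j).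
  move=> jm; apply: (psd_energy hm CW_design).
    exact: (psd_nodal hm CW_design sB B01 mE CW_sqr).
  by rewrite size_nodal// size_cat /Z size_cat size_nseq; lia.
have sint_h (mu : probability (sphere R hn) R) : poly_energy mu h - sphere_average hn h =
    \sum_(j < m) c j * (poly_energy mu (nodal (Z ++ B) j) - sphere_average hn (nodal (Z ++ B) j)).
  rewrite /h /newton (linear_sum (poly_energy mu)) (linear_sum (sphere_average hn)) /= -sumrB.
  apply: eq_bigr => j _.
  by rewrite mulrBr; congr (_ - _); exact: linearZ.
have nodal0 (mu : probability (sphere R hn) R) : poly_energy mu (nodal (Z ++ B) 0) = sphere_average hn (nodal (Z ++ B) 0).
  by rewrite /nodal take0 big_nil poly_energy1 sphere_average1.
have term_ge0 (mu : probability (sphere R hn) R) (j : 'I_m) : true ->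
    0 <= c j * (poly_energy mu (nodal (Z ++ B) j) - sphere_average hn (nodal (Z ++ B) j)).
  move=> _; have [j0|j0] := posnP j; first by rewrite j0 nodal0 subrr mulr0.
  by apply: mulr_ge0; [apply: c_ge0; rewrite j0 /=|rewrite subr_ge0 psd_gap].
have sint_ge (mu : probability (sphere R hn) R) : 0 <= poly_energy mu h - sphere_average hn h.
  by rewrite sint_h; apply: sumr_ge0; exact: term_ge0.
have D_kappa : \int[(kappa CW \x kappa CW)%E]_z D z = 0.
  rewrite kappa_double_integral//; apply: big1 => i _; apply: big1 => j _.
  rewrite DE /=; case: eqP => [_|/eqP s1]; first by rewrite mulr0.
  have := CW_sqr i j; rewrite mem_rcons inE (negbTE s1) /= => sZ.
  by rewrite fZ// subrr mulr0.
have energy_kappa : energy f (kappa CW) = sphere_average hn h + gap * fine (theta (kappa CW)).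
  by rewrite split_energy D_kappa addr0 (poly_energy_kappa hm CW_design).
have intD_ge0 (mu : probability (sphere R hn) R) : 0 <= \int[(mu \x mu)%E]_z D z by exact: Rintegral_ge0.
(* The energy excess is now a sum of three nonnegative terms. *)
split; first by rewrite energyE kappa_double_integral.
split=> [mu tmu|fpos mu tmu].
  have tle : fine (theta (kappa CW)) <= fine (theta mu) by rewrite fine_le.
  rewrite energy_kappa split_energy.
  rewrite -[leLHS]addr0; apply: lerD; last exact: intD_ge0.
  by apply: lerD; [rewrite -subr_ge0; exact: sint_ge|rewrite ler_wpM2l].
have [c_gt0 err_gt0] := strict fpos.
have gap_gt0 : 0 < gap by exact: err_gt0.
have tle : fine (theta (kappa CW)) <= fine (theta mu) by rewrite fine_le.
have M1 := product_setT mu mu.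
have suppE : [set z | D z != 0] = dot_in (`]-1, 1[ `\` range alpha).
  apply/seteqP; split=> z; rewrite /dot_in /= DE in_itv/=.
    case: (sdot z.1 z.2 ^+ 2 =P 1) => [_ /eqP //|/eqP s1 Dn0].
    have t1 : -1 < sdot z.1 z.2 < 1.
      have /andP[a b] := sdot_bound z.1 z.2.
      have tN1 : sdot z.1 z.2 != -1 by apply: contra s1 => /eqP ->; rewrite sqrrN expr1n.
      have tn1 : sdot z.1 z.2 != 1 by apply: contra s1 => /eqP ->; rewrite expr1n.
      by rewrite !lt_neqAle a b !andbT tn1 andbT eq_sym.
    split=> // /(rangeP _ t1) sZ; move: Dn0; by rewrite fZ// subrr eqxx.
  move=> [t1 nr]; case: (sdot z.1 z.2 ^+ 2 =P 1) => [s1|_].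
    have : K z by apply/KE.
    by move: t1 => /andP[a b] [t|t]; rewrite t ltxx in a b.
  rewrite gt_eqF// err_gt0//; first exact: sdot_sqr_bound.
  by apply/negP => sZ; apply: nr; apply/rangeP.
split=> [eqE|[des D0 teq]].
  have [S0 T0 I0] : [/\ poly_energy mu h - sphere_average hn h = 0,
      fine (theta mu) = fine (theta (kappa CW)) & \int[(mu \x mu)%E]_z D z = 0].
    have h3 : 0 <= gap * (fine (theta mu) - fine (theta (kappa CW))).
      by apply: mulr_ge0 => //; rewrite subr_ge0.
    have [|h1 h4 h2] := ge0_sum3_eq0 (sint_ge mu) h3 (intD_ge0 mu).
      by move: eqE; rewrite energy_kappa split_energy; move=> /eqP; rewrite -subr_eq0 => /eqP <-; ring.
    split=> //; by move/eqP: h4; rewrite mulf_eq0 gt_eqF//= subr_eq0 => /eqP.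
  split.
  - apply/(is_designP _ hm) => q sq.
    have [a ->] := @poly_triangular_span R (nodal (Z ++ B)) m q
      (fun l lm => size_nodal (T := Z ++ B) (k := l) ltac:(rewrite size_cat /Z size_cat size_nseq; lia)) sq.
    have nodE (j : 'I_m) : poly_energy mu (nodal (Z ++ B) j) = sphere_average hn (nodal (Z ++ B) j).
      have [j0|j0] := posnP j; first by rewrite j0 nodal0.
      move/eqP: S0; rewrite sint_h psumr_eq0; last exact: term_ge0.
      move=> /allP /(_ j (mem_index_enum _)) /=; rewrite mulf_eq0 gt_eqF ?c_gt0 ?j0//=.
      by rewrite subr_eq0 => /eqP.
    rewrite (linear_sum (poly_energy mu)) (linear_sum (sphere_average hn)) /=; apply: eq_bigr => j _.
    transitivity (a j * poly_energy mu (nodal (Z ++ B) j)); first exact: linearZ.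
    by rewrite nodE; apply/esym; exact: linearZ.
  - by rewrite -suppE; apply/(expect_eq0 M1 bD).
  - by rewrite -[LHS]fineK// -[RHS]fineK// T0.
rewrite energy_kappa split_energy ((is_designP mu hm).1 des)// teq.
by rewrite ((expect_eq0 M1 bD D_ge0).2 _) ?addr0// suppE.
Qed.
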